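(* Let $(M,\mathbf g)$ and $(\widehat M,\widehat{\mathbf g})$ be oriented two-dimensional Riemannian manifolds with Gaussian curvatures $K$ and $\widehat K$, and assume that $K-\widehat K$ never vanishes, i.e. $K(x)\ne\widehat K(\widehat x)$ for all $x\in M$, $\widehat x\in\widehat M$. Let $q(t)$ be a rolling without twisting or slipping of $M$ on $\widehat M$, such that $\gamma=\pi\circ q$ has minimal length among all projections to $M$ of rollings without twisting or slipping with the same initial and final configurations as $q$, and let $\gamma$ be parametrized by arc length. Put $e_1(t)=\dot\gamma(t)$, let $e_2(t)$ be the unit vector field along $\gamma$ such that $e_1(t),e_2(t)$ is a positively oriented orthonormal basis, and let $\kappa(t)=\langle\nabla_{\dot\gamma}e_1(t),e_2(t)\rangle_{\mathbf g}$ be the geodesic curvature of $\gamma$. Let $V(t)$ and $\Lambda(t)$ be a vector field and a two-vector field along $\gamma(t)$ satisfying $$\nabla_{\dot\gamma}\dot\gamma=R(\Lambda)\dot\gamma-\widehat R^{q}(\Lambda)\dot\gamma,\qquad\nabla_{\dot\gamma}\Lambda=\dot\gamma\wedge V,\qquad\nabla_{\dot\gamma}V=\widehat R^{q}(\Lambda)\dot\gamma,$$ and write $\Lambda(t)=\Lambda(t)\,e_1(t)\wedge e_2(t)$ (using the same symbol for the coefficient function) and $V(t)=v_1(t)e_1(t)+v_2(t)e_2(t)$. (a) If $\widehat K$ is constant, then $v_1(t)^2+v_2(t)^2+\widehat K\Lambda(t)^2$ is also constant. (b) If $\widehat K\equiv0$, then there are constants $A$ and $\theta_0$ such that $\theta(t)=\theta_0+\int_0^t\kappa(s)\,ds$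 is a solution to $$\frac{d}{dt}\left(\frac{\dot\theta(t)}{K(t)}\right)=A\sin\theta(t),\qquad K(t):=K(\gamma(t)).$$ (c) If both $K$ and $\widehat K$ are constant, then there are constants $A$ and $\theta_0$ such that $\theta(t)=\theta_0+\int_0^t\kappa(s)\,ds$ is a solution to $\ddot\theta(t)=A\sin\theta(t)$.
   Context: All manifolds are smooth and connected. The configuration space is $Q=\{q:T_xM\to T_{\widehat x}\widehat M\text{ orientation-preserving linear isometry}: x\in M,\widehat x\in\widehat M\}$, with natural projections $\pi:Q\to M$, $\widehat\pi:Q\to\widehat M$. A rolling without twisting or slipping is an absolutely continuous curve $q(t)$ in $Q$ such that, with $\gamma=\pi\circ q$ and $\widehat\gamma=\widehat\pi\circ q$: $q(t)\dot\gamma(t)=\dot{\widehat\gamma}(t)$ for almost every $t$, and a vector field $X(t)$ along $\gamma$ is parallel if and only if $q(t)X(t)$ is parallel along $\widehat\gamma$ (Levi-Civita connections). $\nabla$ is the Levi-Civita connection of $\mathbf g$, $R(X,Y)=\nabla_X\nabla_Y-\nabla_Y\nabla_X-\nabla_{[X,Y]}$, and $\widehat R$ is defined likewise on $\widehat M$. For $q\in\pi^{-1}(x)$ and $v_j\in T_xM$, $\widehat R^q(v_1,v_2)v_3:=q^{-1}\widehat R(qv_1,qv_2)qv_3$. For $\Lambda=\sum_{r,s}\Lambda_{rs}v_r\wedge v_s\in\bigwedge^2T_xM$, $R(\Lambda):=\sum_{r,s}\Lambda_{rs}R(v_r,v_s)$, and similarly $\widehat R^q(\Lambda)$. (Such $V$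 and $\Lambda$ exist along every minimizer considered here, by the paper's theorem on optimal rollings.) *)

(* Defs.v *)
From HB Require Import structures.
From mathcomp Require Import all_boot all_order all_algebra.
From mathcomp Require Import ring.
From mathcomp Require Import all_classical all_reals all_analysis.

Set Implicit Arguments.
Unset Strict Implicit.
Unset Printing Implicit Defensive.

Import Order.TTheory GRing.Theory Num.Theory.
Import numFieldNormedType.Exports.

Local Open Scope classical_set_scope.
Local Open Scope ring_scope.

(* Vectors are row vectors; matrices act on the right, as for the library's
   [jacobian]. *)

Section Calculus.
Variable R : realType.

Fixpoint smooth_upto (V W : normedModType R) (k : nat) (U : set V)
    (f : V -> W) : Prop :=
  if k is k'.+1 then
    (forall p, U p -> differentiable f p) /\
    (forall v, smooth_upto k' U (fun p => 'D_v f p))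
  else forall p, U p -> {for p, continuous f}.

Definition smooth_on (V W : normedModType R) (U : set V) (f : V -> W) :=
  forall k, smooth_upto k U f.

(* Derivative of f at t relative to the set I: one-sided at the end points when
   I is a segment. *)
Definition diff_quot (V : normedModType R) (f : R -> V) (t s : R) : V :=
  (s - t)^-1 *: (f s - f t).

Definition derivable_in (V : normedModType R) (I : set R) (f : R -> V) t :=
  cvg (diff_quot f t s @[s --> within I t^']).

Definition derive_in (V : normedModType R) (I : set R) (f : R -> V) t : V :=
  lim (diff_quot f t s @[s --> within I t^']).

Definition abs_continuous (V : normedModType R) (a b : R) (f : R -> V) :=
  forall e : R, 0 < e -> exists2 d : R, 0 < d &
    forall (k : nat) (u v : 'I_k -> R),
      (forall i, [/\ a <= u i, u i <= v i & v i <= b]) ->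
      (forall i j, i != j -> v i <= u j \/ v j <= u i) ->
      \sum_(i < k) (v i - u i) < d ->
      \sum_(i < k) `|f (v i) - f (u i)| < e.

End Calculus.

Section LocalGeometry.
Variables (R : realType) (n : nat).
Notation vec := 'rV[R]_n.
Implicit Types (G : vec -> 'M[R]_n) (p u v w : vec) (X Y Z : vec -> vec).

Definition ev (i : 'I_n) : vec := delta_mx 0 i.

Definition dotG (g : 'M[R]_n) u v : R := (u *m g *m v^T) 0 0.

(* Levi-Civita connection of the metric G in a chart:
   nabla_u v = D_u v + v *m connG G p u.  This is Koszul's formula
   2 <Gamma(u, e_j), e_k> = D_u <e_j, e_k> + D_(e_j) <u, e_k> - D_(e_k) <u, e_j>;
   connG_torsion_free and connG_metric below are the two properties that
   characterize the Levi-Civita connection. *)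
Definition connG G p u : 'M[R]_n :=
  2^-1 *: (\matrix_(j, k) ('D_u G p j k
             + (u *m 'D_(ev j) G p) 0 k - (u *m 'D_(ev k) G p) 0 j))
  *m invmx (G p).

Definition nablaG G X Y : vec -> vec :=
  fun p => 'D_(X p) Y p + Y p *m connG G p (X p).

Definition lie_bracket X Y : vec -> vec :=
  fun p => 'D_(X p) Y p - 'D_(Y p) X p.

Definition riemannG G X Y Z : vec -> vec :=
  fun p => nablaG G X (nablaG G Y Z) p - nablaG G Y (nablaG G X Z) p
           - nablaG G (lie_bracket X Y) Z p.

(* Value on tangent vectors, extended to fields that are constant in the
   chart. *)
Definition curvG G p u v w : vec :=
  riemannG G (fun=> u) (fun=> v) (fun=> w) p.

(* A two-vector sum_(r < s) L r s e_r /\ e_s is encoded by the antisymmetric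
   matrix L. *)
Definition wedge u v : 'M[R]_n := u^T *m v - v^T *m u.

(* sum_(r, s) L_rs F(e_r, e_s) w where Lambda = sum_(r, s) L_rs e_r /\ e_s; the
   factor 1/2 is there because Lambda is encoded by
   sum_(r, s) L_rs wedge e_r e_s = L - L^T. *)
Definition on_bivector (F : vec -> vec -> vec -> vec) (L : 'M[R]_n) w : vec :=
  2^-1 *: \sum_(r < n) \sum_(s < n) L r s *: F (ev r) (ev s) w.

End LocalGeometry.

Section LeviCivita.
Variables (R : realType) (n : nat).
Notation vec := 'rV[R]_n.

Lemma derive_sym (G : vec -> 'M[R]_n) (p w : vec) :
  differentiable G p -> (\forall q \near p, (G q)^T = G q) ->
  ('D_w G p)^T = 'D_w G p.
Proof.
move=> dG sG; have dGw : derivable G p w by exact: diff_derivable.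
rewrite derive_mx //; apply/matrixP => i j; rewrite !mxE.
by apply: near_eq_derive; apply: filterS sG => q {2}<-; rewrite mxE.
Qed.

Lemma connG_torsion_free (G : vec -> 'M[R]_n) (p u v : vec) :
  differentiable G p -> (\forall q \near p, (G q)^T = G q) ->
  v *m connG G p u = u *m connG G p v.
Proof.
move=> dG nG; have sG w : ('D_w G p)^T = 'D_w G p by exact: derive_sym.
rewrite /connG !mulmxA; congr (_ *m _).
rewrite -!scalemxAr; congr (_ *: _).
have DE (w : vec) : 'D_w G p = \sum_i w 0 i *: 'D_(ev R i) G p.
  rewrite deriveE // [w in LHS]row_sum_delta linear_sum.
  by apply: eq_bigr => i _; rewrite linearZ deriveE.
have mulDE (a w : vec) k : (a *m 'D_w G p) 0 k =
    \sum_i w 0 i * (a *m 'D_(ev R i) G p) 0 k.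
  rewrite DE mulmx_sumr summxE; apply: eq_bigr => i _.
  by rewrite -scalemxAr mxE.
have sym (a w : vec) k : \sum_j w 0 j * (a *m 'D_(ev R k) G p) 0 j
    = \sum_j a 0 j * (w *m 'D_(ev R k) G p) 0 j.
  under eq_bigr do rewrite mxE big_distrr.
  under [RHS]eq_bigr do rewrite mxE big_distrr.
  rewrite exchange_big; apply: eq_bigr => i _; apply: eq_bigr => j _ /=.
  by rewrite -[in RHS]sG [in RHS]mxE mulrCA.
have E (a w : vec) k :
   (w *m \matrix_(j, k) ('D_a G p j k
      + (a *m 'D_(ev R j) G p) 0 k - (a *m 'D_(ev R k) G p) 0 j)) 0 k
   = (w *m 'D_a G p) 0 k + (a *m 'D_w G p) 0 k
     - \sum_j w 0 j * (a *m 'D_(ev R k) G p) 0 j.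
  rewrite mxE; under eq_bigr do rewrite mxE mulrBr mulrDr.
  rewrite sumrB big_split /=; congr (_ + _ - _); first by rewrite mxE.
  by rewrite -mulDE.
apply/rowP => k; apply: etrans (E u v k) _; apply/esym/(etrans (E v u k)).
rewrite (sym u v k); have aux (a b c : R) : a + b - c = b + a - c by ring.
exact: aux.
Qed.

Lemma connG_metric (G : vec -> 'M[R]_n) (p w : vec) :
  differentiable G p -> (\forall q \near p, (G q)^T = G q) ->
  G p \in unitmx ->
  'D_w G p = connG G p w *m G p + G p *m (connG G p w)^T.
Proof.
move=> dG nG uG; have sG u : ('D_u G p)^T = 'D_u G p by exact: derive_sym.
have E j k : (connG G p w *m G p) j k = 2^-1 * ('D_w G p j k
    + (w *m 'D_(ev R j) G p) 0 k - (w *m 'D_(ev R k) G p) 0 j).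
  by rewrite /connG mulmxKV // [LHS]mxE [X in _ * X]mxE.
have S j k : 'D_w G p k j = 'D_w G p j k by rewrite -[in LHS]sG mxE.
rewrite -{2}(nbhs_singleton nG) -trmx_mul; apply/matrixP => j k.
rewrite [RHS]mxE [X in _ + X]mxE (E j k) (E k j) S.
have aux (a b c : R) : a = 2^-1 * (a + b - c) + 2^-1 * (a + c - b) by field.
exact: aux.
Qed.

End LeviCivita.

(* An oriented Riemannian manifold given by an atlas of charts
   [chart i : dom i -> 'rV_n] with smooth orientation-preserving transition
   maps.  Outside [dom i] (resp. its image) the values of [chart i] (resp.
   [chart_inv i]) are irrelevant.  [metric i p] is the Gram matrix of g at
   [chart_inv i p] in the chart i. *)
Record orientedRiemannian (R : realType) (n : nat) := OrientedRiemannian {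
  carrier :> topologicalType ;
  carrier_hausdorff : hausdorff_space carrier ;
  carrier_second_countable : @second_countable carrier ;
  carrier_connected : connected [set: carrier] ;
  atlas : Type ;
  dom : atlas -> set carrier ;
  chart : atlas -> carrier -> 'rV[R]_n ;
  chart_inv : atlas -> 'rV[R]_n -> carrier ;
  chart_at : carrier -> atlas ;
  dom_chart_at : forall x, dom (chart_at x) x ;
  dom_open : forall i, open (dom i) ;
  img_open : forall i, open (chart i @` dom i) ;
  chartK : forall i x, dom i x -> chart_inv i (chart i x) = x ;
  chart_continuous : forall i x, dom i x -> {for x, continuous (chart i)} ;
  chart_inv_continuous : forall i p, (chart i @` dom i) p ->
    {for p, continuous (chart_inv i)} ;
  transition_smooth : forall i j,
    smooth_on (chart i @` (dom i `&` dom j)) (chart j \o chart_inv i) ;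
  transition_oriented : forall i j x, dom i x -> dom j x ->
    0 < \det (jacobian (chart j \o chart_inv i) (chart i x)) ;
  metric : atlas -> 'rV[R]_n -> 'M[R]_n ;
  metric_smooth : forall i, smooth_on (chart i @` dom i) (metric i) ;
  metric_sym : forall i p, (chart i @` dom i) p -> (metric i p)^T = metric i p ;
  metric_posdef : forall i p, (chart i @` dom i) p ->
    forall u, u != 0 -> 0 < dotG (metric i p) u u ;
  metric_compat : forall i j x, dom i x -> dom j x ->
    let J := jacobian (chart j \o chart_inv i) (chart i x) in
    metric i (chart i x) = J *m metric j (chart j x) *m J^T
}.

(* A tangent vector at x is given by its coordinates in the chart
   [chart_at x]; so a vector field along a curve is a function R -> 'rV_n, and a
   two-vector field along a curve a function R -> 'M_n.  [jac i j x] converts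
   coordinates at x in the chart i to coordinates in the chart j. *)
Section Manifold.
Variables (R : realType) (n : nat) (M : orientedRiemannian R n).
Notation vec := 'rV[R]_n.
Implicit Types (x : M) (u v w : vec) (I : set R) (c : R -> M) (t : R).

Definition jac (i j : atlas M) x : 'M[R]_n :=
  jacobian (chart j \o chart_inv i) (chart i x).

Definition coords x : vec := chart (chart_at x) x.

Definition inner x u v : R := dotG (metric (chart_at x) (coords x)) u v.

Definition tnorm x u : R := Num.sqrt (inner x u u).

Definition conn x u : 'M[R]_n := connG (metric (chart_at x)) (coords x) u.

Definition curv x u v w : vec := curvG (metric (chart_at x)) (coords x) u v w.

Definition curve_derivable I c t : Prop :=
  c s @[s --> within I (nbhs t)] --> c t /\
  derivable_in I (chart (chart_at (c t)) \o c) t.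

Definition velocity I c t : vec :=
  derive_in I (chart (chart_at (c t)) \o c) t.

Definition vec_coords c (X : R -> vec) (i : atlas M) : R -> vec :=
  fun s => X s *m jac (chart_at (c s)) i (c s).

Definition bivec_coords c (L : R -> 'M[R]_n) (i : atlas M) : R -> 'M[R]_n :=
  fun s => let J := jac (chart_at (c s)) i (c s) in J^T *m L s *m J.

Definition field_derivable I c (X : R -> vec) t : Prop :=
  curve_derivable I c t /\
  derivable_in I (vec_coords c X (chart_at (c t))) t.

Definition covD I c (X : R -> vec) t : vec :=
  derive_in I (vec_coords c X (chart_at (c t))) t
  + X t *m conn (c t) (velocity I c t).

Definition bifield_derivable I c (L : R -> 'M[R]_n) t : Prop :=
  curve_derivable I c t /\
  derivable_in I (bivec_coords c L (chart_at (c t))) t.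

(* Leibniz rule: nabla (v /\ w) = nabla v /\ w + v /\ nabla w. *)
Definition covD_bivec I c (L : R -> 'M[R]_n) t : 'M[R]_n :=
  let C := conn (c t) (velocity I c t) in
  derive_in I (bivec_coords c L (chart_at (c t))) t + C^T *m L t + L t *m C.

Definition ac_curve (T : R) c : Prop :=
  {within `[0, T], continuous c} /\
  forall (i : atlas M) (a b : R), 0 <= a -> a <= b -> b <= T ->
    (forall t, a <= t <= b -> dom i (c t)) ->
    abs_continuous a b (chart i \o c).

Definition ac_field (T : R) c (X : R -> vec) : Prop :=
  forall (i : atlas M) (a b : R), 0 <= a -> a <= b -> b <= T ->
    (forall t, a <= t <= b -> dom i (c t)) ->
    abs_continuous a b (vec_coords c X i).

Definition parallel (T : R) c (X : R -> vec) : Prop :=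
  ac_field T c X /\
  \forall t \ae (@lebesgue_measure R), 0 <= t <= T ->
    field_derivable `[0, T] c X t /\ covD `[0, T] c X t = 0.

Definition curve_length (T : R) c : \bar R :=
  (\int[@lebesgue_measure R]_(t in `[0%R, T])
     (tnorm (c t) (velocity `[0, T] c t))%:E)%E.

End Manifold.

Section Rolling.
Variables (R : realType) (n : nat) (M Mh : orientedRiemannian R n).
Notation vec := 'rV[R]_n.

(* The configuration space Q: an isometry v |-> v *m iso from T_foot M to
   T_foot_h Mh; foot and foot_h are the projections to M and Mh.  The charts are
   oriented, so iso preserves the orientation iff its determinant is positive. *)
Record config := Config {
  foot : M ;
  foot_h : Mh ;
  iso : 'M[R]_n ;
  iso_isometry : forall u v,
    inner foot_h (u *m iso) (v *m iso) = inner foot u v ;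
  iso_oriented : 0 < \det iso
}.

Definition ac_config (T : R) (q : R -> config) : Prop :=
  [/\ ac_curve T (foot \o q), ac_curve T (foot_h \o q) &
   forall (i : atlas M) (j : atlas Mh) (a b : R), 0 <= a -> a <= b -> b <= T ->
     (forall t, a <= t <= b -> dom i (foot (q t)) /\ dom j (foot_h (q t))) ->
     abs_continuous a b (fun t =>
       jac i (chart_at (foot (q t))) (foot (q t)) *m iso (q t)
       *m jac (chart_at (foot_h (q t))) j (foot_h (q t)))].

Definition rolling (T : R) (q : R -> config) : Prop :=
  [/\ ac_config T q,
   \forall t \ae (@lebesgue_measure R), 0 <= t <= T ->
     [/\ curve_derivable `[0, T] (foot \o q) t,
         curve_derivable `[0, T] (foot_h \o q) t &
         velocity `[0, T] (foot \o q) t *m iso (q t)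
         = velocity `[0, T] (foot_h \o q) t] &
   forall X : R -> vec,
     parallel T (foot \o q) X <->
     parallel T (foot_h \o q) (fun t => X t *m iso (q t))].

Definition minimal_rolling (T : R) (q : R -> config) : Prop :=
  rolling T q /\
  forall (S : R) (p : R -> config), 0 < S -> rolling S p ->
    p 0 = q 0 -> p S = q T ->
    (curve_length T (foot \o q) <= curve_length S (foot \o p))%E.

Definition curvh (q : config) (u v w : vec) : vec :=
  curv (foot_h q) (u *m iso q) (v *m iso q) (w *m iso q) *m invmx (iso q).

End Rolling.

(* Gaussian curvature as the sectional curvature
   K (|u|^2 |v|^2 - <u, v>^2) = <R(u, v) v, u>.  K is prescribed in all charts:
   this determines K, and such a K always exists because the curvature tensor
   does not depend on the chart. *)
Definition gaussian_curvature (R : realType) (M : orientedRiemannian R 2)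
    (K : M -> R) : Prop :=
  forall (i : atlas M) (x : M), dom i x -> forall u v : 'rV[R]_2,
    let g := metric i (chart i x) in
    dotG g (curvG (metric i) (chart i x) u v v) u =
    K x * (dotG g u u * dotG g v v - dotG g u v ^+ 2).

Definition pos_orthonormal (R : realType) (M : orientedRiemannian R 2) (x : M)
    (u v : 'rV[R]_2) : Prop :=
  [/\ inner x u u = 1, inner x u v = 0, inner x v v = 1 &
      0 < \det (col_mx u v : 'M[R]_2)].

Definition has_derivative_on (R : realType) (T : R) (f f' : R -> R) : Prop :=
  forall t, 0 <= t <= T ->
    derivable_in `[0, T] f t /\ derive_in `[0, T] f t = f' t.

(* theta(t) = theta0 + int_0^t kappa(s) ds; [pendulum] and [pendulum_over] say
   that theta solves theta'' = A sin theta, resp. (theta' / K)' = A sin theta,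
   on [0, T]. *)
Definition angle (R : realType) (kappa : R -> R) (theta0 t : R) : R :=
  theta0 + \int[@lebesgue_measure R]_(s in `[0, t]) kappa s.

Definition pendulum_over (R : realType) (T : R) (kappa K : R -> R)
    (A theta0 : R) : Prop :=
  let theta := angle kappa theta0 in
  (@lebesgue_measure R).-integrable `[0, T] (EFin \o kappa) /\
  exists2 dtheta : R -> R, has_derivative_on T theta dtheta &
    has_derivative_on T (fun t => dtheta t / K t) (fun t => A * sin (theta t)).

Definition pendulum (R : realType) (T : R) (kappa : R -> R)
    (A theta0 : R) : Prop :=
  let theta := angle kappa theta0 in
  (@lebesgue_measure R).-integrable `[0, T] (EFin \o kappa) /\
  exists2 dtheta : R -> R, has_derivative_on T theta dtheta &
    has_derivative_on T dtheta (fun t => A * sin (theta t)).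

(* Main.v *)
(* Along gamma the frame e1, e2 satisfies nabla e1 = kappa e2, and in dimension
   two the equations for V and Lambda become the scalar system
     kappa = - lambda (K - Kh),  lambda' = v2,
     v1' = kappa v2,             v2' = - kappa v1 - Kh lambda,
   where lambda and v2 are the areas of the two-vectors Lambda and e1 /\ V, so
   that e2 never has to be differentiated.  For (a) the proposed invariant has
   derivative zero.  In (b) and (c) the pair (v1 - h, v2), with h = 0, resp.
   h = kh / (k - kh), rotates with angular speed kappa, so v2 = - r sin theta,
   while kappa / K = - lambda, resp. kappa = - (k - kh) lambda. *)
Require Import Defs.
From HB Require Import structures.
From mathcomp Require Import all_boot all_order all_algebra.
From mathcomp Require Import ring.
From mathcomp Require Import all_classical all_reals all_analysis.

Set Implicit Arguments.
Unset Strict Implicit.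
Unset Printing Implicit Defensive.

Import Order.TTheory GRing.Theory Num.Theory.
Import numFieldNormedType.Exports.

Local Open Scope classical_set_scope.
Local Open Scope ring_scope.

(** * Derivatives relative to a segment *)

(** Two obstacles shape the proof. [chart_at] may jump from one point of a curve to the next, so
    [inner] and the components of fields cannot be differentiated as they stand. Each derivative at
    [t] is computed in the single chart [chart_at (c t)], which covers the curve near [t], and
    invariance under change of chart brings the result back. The other obstacle is regularity:
    [theta] is an integral, and getting [theta' = kappa] at every point of the segment, end points
    included, uses continuity of [kappa]. In (c) [kappa] is a constant multiple of the
    differentiable function [lambda]. In (b) it is [- lambda K], and [K] is given only through the
    identity for the sectional curvature, so its continuity has to be derived from the smoothness of
    the metric. The calculus of continuously differentiable maps serves this, and also the linearity
    of the curvature in its first argument. *)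

Definition deriv_in (R : realType) (V : normedModType R) (I : set R)
  (f : R -> V) (t : R) (d : V) : Prop :=
  diff_quot f t s @[s --> within I t^'] --> d.

Section RelativeDerivative.
Variables (R : realType) (I : set R) (t : R).
Hypothesis It : I t.

(* A derivative relative to I is an ordinary derivative of the function
   extended affinely off I, so the calculus rules carry over. *)
Lemma deriv_in_extend (V : normedModType R) (f : R -> V) d :
  deriv_in I f t d ->
  exists2 g : R -> V, (forall s, I s -> g s = f s) & is_derive t 1 g d.
Proof.
move=> fd; pose g s := if `[< I s >] then f s else f t + (s - t) *: d.
have gI s : I s -> g s = f s by move=> Is; rewrite /g asboolT.
exists g => //.
suff H : (fun h : R => h^-1 *: ((g \o shift t) (h *: 1) - g t)) @ 0^' --> d.
  by split; [exact: cvgP H | exact: cvg_lim H].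
apply/cvgrPdist_le => e e0.
move/cvgrPdist_le : fd => /(_ _ e0) [r /= r0 H].
exists r => //= h; rewrite /ball /= sub0r normrN => hr h0.
rewrite (gI t) // /g /= [h *: 1]mulr1; case: asboolP => Ih.
  have := H (h + t); rewrite /diff_quot /= addrK.
  rewrite /ball /= opprD addrCA subrr addr0 normrN; apply => //.
  by rewrite -subr_eq0 addrK.
rewrite addrK [f t + _]addrC addrK scalerA mulVf //.
by rewrite scale1r subrr normr0 ltW.
Qed.

Lemma is_derive_deriv_in (V : normedModType R) (f g : R -> V) d :
  (\forall s \near within I (nbhs t), g s = f s) ->
  is_derive t 1 g d -> deriv_in I f t d.
Proof.
move=> [e /= e0 gf] [/= dg <-]; apply/cvgrPdist_le => e' e'0.
move/cvgrPdist_le : dg => /(_ _ e'0) [r /= r0 H].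
exists (Num.min e r); first by rewrite /= lt_min e0 r0.
move=> s; rewrite /ball /= lt_min => /andP[se sr] st Is.
rewrite /diff_quot -!gf //; last by rewrite /ball /= subrr normr0.
have := H (s - t); rewrite /= [_ *: 1]mulr1 subrK; apply.
  by rewrite /ball /= sub0r opprB.
by rewrite subr_eq0.
Qed.

Lemma deriv_in_near (V : normedModType R) (f g : R -> V) d :
  (\forall s \near within I (nbhs t), f s = g s) ->
  deriv_in I f t d -> deriv_in I g t d.
Proof.
move=> fg /deriv_in_extend[h hf dh]; apply: is_derive_deriv_in dh.
by case: fg => e e0 fg; exists e => //= s se Is; rewrite hf ?fg.
Qed.

Lemma deriv_in_eq (V : normedModType R) (f g : R -> V) d :
  (forall s, I s -> f s = g s) -> deriv_in I f t d -> deriv_in I g t d.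
Proof. by move=> fg; apply: deriv_in_near; exists 1 => //= s _; exact: fg. Qed.

Lemma deriv_in_comp (V W : normedModType R) (f : R -> V) (F : V -> W) d :
  differentiable F (f t) -> deriv_in I f t d ->
  deriv_in I (F \o f) t ('D_d F (f t)).
Proof.
move=> dF /deriv_in_extend[g gf dg].
apply: (@is_derive_deriv_in _ _ (F \o g)).
  by exists 1 => //= s _ Is; rewrite gf.
have dg' : differentiable g t by apply/derivable1_diffP.
rewrite -gf // in dF *.
have dFg : differentiable (F \o g) t by apply: differentiable_comp.
apply: DeriveDef; first exact: diff_derivable.
rewrite deriveE // diff_comp //= deriveE //; congr ('d F _ _).
by rewrite -deriveE // derive_val.
Qed.

Lemma deriv_in_cst (V : normedModType R) (a : V) : deriv_in I (fun=> a) t 0.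
Proof. by apply: is_derive_deriv_in (is_derive_cst a _ _); exists 1 => /=. Qed.

Lemma deriv_inD (V : normedModType R) (f g : R -> V) df dg :
  deriv_in I f t df -> deriv_in I g t dg ->
  deriv_in I (fun s => f s + g s) t (df + dg).
Proof.
move=> /deriv_in_extend[f' ff df'] /deriv_in_extend[g' gg dg'].
apply: is_derive_deriv_in (is_deriveD df' dg').
by exists 1 => //= s _ Is; rewrite -ff // -gg.
Qed.

Lemma deriv_inM (f g : R -> R) df dg :
  deriv_in I f t df -> deriv_in I g t dg ->
  deriv_in I (fun s => f s * g s) t (df * g t + f t * dg).
Proof.
move=> /deriv_in_extend[f' ff df'] /deriv_in_extend[g' gg dg'].
have := is_deriveM df' dg'.
rewrite ff // gg // addrC /GRing.scale /= [g t * _]mulrC.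
apply: is_derive_deriv_in.
by exists 1 => //= s _ Is; rewrite -ff // -gg.
Qed.

Lemma deriv_inZ (k : R) (f : R -> R) df :
  deriv_in I f t df -> deriv_in I (fun s => k * f s) t (k * df).
Proof.
by move=> /(deriv_inM (deriv_in_cst k)); rewrite mul0r add0r.
Qed.

Lemma deriv_inB (V : normedModType R) (f g : R -> V) df dg :
  deriv_in I f t df -> deriv_in I g t dg ->
  deriv_in I (fun s => f s - g s) t (df - dg).
Proof.
move=> /deriv_in_extend[f' ff df'] /deriv_in_extend[g' gg dg'].
apply: is_derive_deriv_in (is_deriveB df' dg').
by exists 1 => //= s _ Is; rewrite -ff // -gg.
Qed.

Lemma deriv_in_mxP m n (A : R -> 'M[R]_(m, n)) dA :
  deriv_in I A t dA <-> forall i j, deriv_in I (fun s => A s i j) t (dA i j).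
Proof.
split=> [/deriv_in_extend[B BA dB] i j|H].
  apply: (@is_derive_deriv_in _ _ (fun s => B s i j)).
    by exists 1 => //= s _ Is; rewrite BA.
  have dB' : derivable B t 1 by [].
  split; first by move/derivable_mxP : dB'.
  by move: (derive_mx dB'); rewrite derive_val => ->; rewrite mxE.
(* The entries are extended off [I] one at a time; [choice] collects the extensions so that they
   form one matrix function on the whole line. *)
have /choice[B HB] : forall ij : 'I_m * 'I_n, exists g : R -> R,
    (forall s, I s -> g s = A s ij.1 ij.2) /\ is_derive t 1 g (dA ij.1 ij.2).
  by move=> ij; have [g gA dg] := deriv_in_extend (H ij.1 ij.2); exists g.
have BA : forall i j s, I s -> B (i, j) s = A s i j by move=> i j; case: (HB (i, j)).
have dB : forall i j, is_derive t 1 (B (i, j)) (dA i j).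
  by move=> i j; case: (HB (i, j)).
apply: (@is_derive_deriv_in _ _ (fun s => \matrix_(i, j) B (i, j) s)).
  by exists 1 => //= s _ Is; apply/matrixP => i j; rewrite mxE BA.
have E i j : (fun s => (\matrix_(i, j) B (i, j) s) i j) = B (i, j).
  by apply/funext => s; rewrite mxE.
have D : derivable (fun s => \matrix_(i, j) B (i, j) s) t 1.
  by apply/derivable_mxP => i j; rewrite E.
split => //; rewrite derive_mx //; apply/matrixP => i j.
by rewrite mxE E; exact: derive_val.
Qed.

Lemma deriv_in_sum (V : normedModType R) n (f : 'I_n -> R -> V) df :
  (forall i, deriv_in I (f i) t (df i)) ->
  deriv_in I (fun s => \sum_(i < n) f i s) t (\sum_(i < n) df i).
Proof.
elim: n f df => [|n IH] f df H.
  by rewrite big_ord0; under eq_fun do rewrite big_ord0; exact: deriv_in_cst.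
rewrite big_ord_recl; under eq_fun do rewrite big_ord_recl.
by apply: deriv_inD => //; apply: IH => i; exact: H.
Qed.

Lemma deriv_in_mulmx m n p (A : R -> 'M[R]_(m, n))
    (B : R -> 'M[R]_(n, p)) dA dB :
  deriv_in I A t dA -> deriv_in I B t dB ->
  deriv_in I (fun s => A s *m B s) t (dA *m B t + A t *m dB).
Proof.
move=> /deriv_in_mxP HA /deriv_in_mxP HB; apply/deriv_in_mxP => i j.
under eq_fun do rewrite mxE; rewrite 3!mxE -big_split /=.
by apply: deriv_in_sum => k; apply: deriv_inM.
Qed.

Lemma deriv_in_trmx m n (A : R -> 'M[R]_(m, n)) dA :
  deriv_in I A t dA -> deriv_in I (fun s => (A s)^T) t dA^T.
Proof.
move=> /deriv_in_mxP H; apply/deriv_in_mxP => i j.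
by rewrite mxE; under eq_fun do rewrite mxE; exact: H.
Qed.

Lemma deriv_in_comp1 (F f : R -> R) d dF :
  is_derive (f t) 1 F dF -> deriv_in I f t d ->
  deriv_in I (F \o f) t (d * dF).
Proof.
move=> DF df; have dF' : differentiable F (f t) by apply/derivable1_diffP.
have -> : d * dF = 'D_d F (f t); last exact: deriv_in_comp.
rewrite -(@derive_val _ _ _ _ _ _ _ DF) !deriveE //.
by rewrite -[in RHS](mulr1 d) [RHS]linearZ.
Qed.

Lemma deriv_in_continuous (V : normedModType R) (f : R -> V) d :
  deriv_in I f t d -> f s @[s --> within I (nbhs t)] --> f t.
Proof.
move=> /deriv_in_extend[g gf dg].
have : {for t, continuous g}.
  by apply: differentiable_continuous; apply/derivable1_diffP.
rewrite /prop_for /continuous_at gf // => cg.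
have cg' : g s @[s --> within I (nbhs t)] --> f t by exact: cvg_within_filter.
apply: cvg_trans cg'.
by apply: near_eq_cvg; exists 1 => //= s _ Is; rewrite gf.
Qed.

End RelativeDerivative.

Section Segment.
Variables (R : realType) (T : R).
Hypothesis T0 : 0 < T.
Let I : set R := `[0, T]%classic.

(** Since [T > 0], every point of the segment, end points included, is a limit point of it. Limits
    are then unique, so [derive_in], which is a [lim], returns the value recorded by [deriv_in]; the
    rules above for [deriv_in] hold without this. *)
Lemma segment_dnbhs_proper t : 0 <= t <= T -> ProperFilter (within I t^').
Proof.
move=> /andP[t0 tT]; apply: Build_ProperFilter => -[e /= e0 H].
have [tT'|] := ltP t T.
  pose s := t + Num.min (e / 2) (T - t).
  have m0 : 0 < Num.min (e / 2) (T - t) by rewrite lt_min divr_gt0 // subr_gt0.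
  apply: (H s).
  - rewrite /ball /= /s opprD addrA subrr add0r normrN gtr0_norm //.
    by rewrite gt_min ltr_pdivrMr // ltr_pMr // ltr1n.
  - by rewrite /s -subr_eq0 addrAC subrr add0r gt_eqF.
  - rewrite /I /= in_itv /= /s addr_ge0 ?(ltW m0) //=.
    by rewrite -lerBrDl ge_min lexx orbT.
(* Only [t = T] is left, where the nearby point has to lie on the other side. *)
move=> Tt; have {tT Tt} tE : t = T by apply/le_anti; rewrite tT.
pose s := t - Num.min (e / 2) t.
have m0 : 0 < Num.min (e / 2) t by rewrite lt_min divr_gt0 // tE.
apply: (H s).
- rewrite /ball /= /s opprB addrCA subrr addr0 gtr0_norm //.
  by rewrite gt_min ltr_pdivrMr // ltr_pMr // ltr1n.
- by rewrite /s -subr_eq0 addrAC subrr add0r oppr_eq0 gt_eqF.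
- rewrite /I /= in_itv /= /s subr_ge0 ge_min lexx orbT /=.
  by rewrite lerBlDr tE ler_wpDr // ltW // -tE.
Qed.

Lemma deriv_in_derive (V : normedModType R) (f : R -> V) t d : 0 <= t <= T ->
  deriv_in I f t d -> derivable_in I f t /\ derive_in I f t = d.
Proof.
move=> tT fd; have F := segment_dnbhs_proper tT.
by split; [exact: cvgP fd | exact: cvg_lim fd].
Qed.

Lemma derivable_inP (V : normedModType R) (f : R -> V) t : 0 <= t <= T ->
  derivable_in I f t -> deriv_in I f t (derive_in I f t).
Proof. by move=> tT fd; have F := segment_dnbhs_proper tT. Qed.

(** The mean value theorem needs ordinary derivatives only at interior points, where they agree with
    the relative ones. All conserved quantities below go through this lemma, which takes the place
    of a uniqueness theorem for differential equations. *)
Lemma deriv_in0_cst (f : R -> R) :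
  (forall t, 0 <= t <= T -> deriv_in I f t 0) ->
  forall t, 0 <= t <= T -> f t = f 0.
Proof.
move=> H t /andP[t0 tT].
have It s : 0 <= s <= T -> I s by rewrite /I /= in_itv.
have [||c _] := @MVT_segment R f (fun=> 0) 0 t t0.
- move=> x; rewrite in_itv /= => /andP[x0 xt].
  have xT : 0 <= x <= T by rewrite ltW //= ltW // (lt_le_trans xt).
  have [g gf dg] := deriv_in_extend (It _ xT) (H _ xT).
  apply: near_eq_is_derive dg.
  have xI : x \in `]0, T[ by rewrite in_itv /= x0 (lt_le_trans xt).
  near=> y; apply: gf; have : y \in `]0, T[ by near: y; exact: near_in_itvoo.
  by rewrite in_itv /= => /andP[? ?]; apply: It; rewrite !ltW.
- have cf : {within I, continuous f}.
    apply/subspace_continuousP => x; rewrite /I /= in_itv => xT.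
    by have := deriv_in_continuous (It _ xT) (H _ xT).
  apply: continuous_subspaceW cf => x /=; rewrite !in_itv /=.
  by move=> /andP[x0 xt]; apply/andP; split; [exact: x0 | exact: le_trans xt tT].
by rewrite mul0r => /eqP; rewrite subr_eq0 => /eqP.
Unshelve. all: by end_near. Qed.

End Segment.

(** * Covariant derivatives in charts *)

Section Plane.
Variable R : realType.
Implicit Types (u v : 'rV[R]_2) (A B G L : 'M[R]_2).

Definition det2 u v : R := u 0 0 * v 0 1 - u 0 1 * v 0 0.

Lemma ord2_eq1 : lift ord0 ord0 = 1 :> 'I_2.
Proof. exact: val_inj. Qed.

Lemma forall_ord2 (P : 'I_2 -> Prop) : P 0 -> P 1 -> forall i, P i.
Proof.
move=> P0 P1 [[|[|//]] h]; first by rewrite (_ : Ordinal h = 0) //; exact: val_inj.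
by rewrite (_ : Ordinal h = 1) //; exact: val_inj.
Qed.

Lemma sum_ord2 (V : nmodType) (F : 'I_2 -> V) : \sum_(i < 2) F i = F 0 + F 1.
Proof. by rewrite big_ord_recl big_ord1 ord2_eq1. Qed.

Lemma addmxE m n (A B : 'M[R]_(m, n)) i j : (A + B) i j = A i j + B i j.
Proof. by rewrite mxE. Qed.

Lemma trmxE m n (A : 'M[R]_(m, n)) i j : A^T i j = A j i.
Proof. by rewrite mxE. Qed.

Lemma mulmx2E m p (A : 'M[R]_(m, 2)) (B : 'M[R]_(2, p)) i j :
  (A *m B) i j = A i 0 * B 0 j + A i 1 * B 1 j.
Proof. by rewrite mxE sum_ord2. Qed.

Lemma det_mx2 A : \det A = A 0 0 * A 1 1 - A 0 1 * A 1 0.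
Proof.
rewrite (expand_det_row _ 0) sum_ord2 /cofactor !det_mx11 !mxE /=.
have -> : lift 1 0 = 0 :> 'I_2 by exact: val_inj.
have -> : lift 0 0 = 1 :> 'I_2 by exact: val_inj.
by rewrite expr0 expr1; ring.
Qed.

Lemma det_col_mx u v : \det (col_mx u v : 'M[R]_2) = det2 u v.
Proof.
have E0 j : (col_mx u v : 'M[R]_2) 0 j = u 0 j.
  by rewrite -(@col_mxEu _ 1 1 2 u v); congr (col_mx u v _ j); exact: val_inj.
have E1 j : (col_mx u v : 'M[R]_2) 1 j = v 0 j.
  by rewrite -(@col_mxEd _ 1 1 2 u v); congr (col_mx u v _ j); exact: val_inj.
by rewrite det_mx2 !E0 !E1.
Qed.

Lemma det2_mulmx u v A : det2 (u *m A) (v *m A) = \det A * det2 u v.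
Proof. by rewrite /det2 !mulmx2E det_mx2; ring. Qed.

Lemma dotGE G u v : dotG G u v =
  u 0 0 * G 0 0 * v 0 0 + u 0 0 * G 0 1 * v 0 1
  + u 0 1 * G 1 0 * v 0 0 + u 0 1 * G 1 1 * v 0 1.
Proof. by rewrite /dotG !mulmx2E !mxE; ring. Qed.

Lemma posdef_det_gt0 G : G^T = G ->
  (forall u, u != 0 -> 0 < dotG G u u) -> 0 < \det G.
Proof.
move=> sG pG; have S : G 1 0 = G 0 1 by rewrite -[in LHS]sG mxE.
have G00 : 0 < G 0 0.
  have := pG (delta_mx 0 0); rewrite dotGE !mxE /= !(mulr0, mul0r, mulr1, mul1r, addr0).
  by apply; apply/eqP => /matrixP/(_ 0 0); rewrite !mxE /= => /eqP; rewrite oner_eq0.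
(* This test vector is [G]-orthogonal to the first basis vector; its squared length is
   [G 0 0 * \det G]. *)
have := pG (\row_j if j == 0 then - G 0 1 else G 0 0).
rewrite dotGE !mxE /= S det_mx2 S => H.
have : 0 < G 0 0 * (G 0 0 * G 1 1 - G 0 1 * G 0 1).
  have -> : G 0 0 * (G 0 0 * G 1 1 - G 0 1 * G 0 1) =
    - G 0 1 * G 0 0 * - G 0 1 + - G 0 1 * G 0 1 * G 0 0
    + G 0 0 * G 0 1 * - G 0 1 + G 0 0 * G 1 1 * G 0 0 by ring.
  apply: H; apply/eqP => /matrixP/(_ 0 1); rewrite !mxE /= => /eqP.
  by rewrite gt_eqF.
by rewrite pmulr_rgt0.
Qed.

End Plane.

Section CovariantDerivative.
Variables (R : realType) (n : nat) (M : orientedRiemannian R n).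
Implicit Types (x : M) (i j : atlas M) (u v w : 'rV[R]_n).

Lemma nbhs_dom i x : dom i x -> nbhs x (dom i).
Proof. by move=> ix; apply: open_nbhs_nbhs; split => //; exact: dom_open. Qed.

Lemma nbhs_img i x : dom i x -> nbhs (chart i x) (chart i @` dom i).
Proof.
by move=> ix; apply: open_nbhs_nbhs; split; [exact: img_open | exists x].
Qed.

Lemma metric_differentiable i x : dom i x ->
  differentiable (metric i) (chart i x).
Proof. by move=> ix; have [+ _] := @metric_smooth _ _ M i 1; apply; exists x. Qed.

Lemma metric_sym_near i x : dom i x ->
  \forall p \near chart i x, (metric i p)^T = metric i p.
Proof. by move=> /nbhs_img; apply: filterS => p; exact: Defs.metric_sym. Qed.

Lemma metric_unit i x : dom i x -> metric i (chart i x) \in unitmx.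
Proof.
move=> ix; rewrite unitmxE unitfE; apply/negP => /det0P[u u0 uG].
have := @metric_posdef _ _ M i (chart i x) (ex_intro2 _ _ x ix erefl) u u0.
by rewrite /dotG uG mul0mx mxE ltxx.
Qed.

(** The composite is known to be the identity only on the open image of the chart, which is enough
    because a Jacobian depends on the germ alone. *)
Lemma jac_refl i x : dom i x -> jac i i x = 1%:M.
Proof.
move=> ix; have near_id : {near chart i x, chart i \o chart_inv i =1 id}.
  by apply: filterS (nbhs_img ix) => _ [y iy <-] /=; rewrite chartK.
have d : differentiable (chart i \o chart_inv i) (chart i x).
  by have [+ _] := @transition_smooth _ _ M i i 1; apply; exists x.
apply/row_matrixP => k; rewrite row1 rowE -deriveEjacobian //.
by rewrite (near_eq_derive _ near_id) derive_id.
Qed.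

Lemma inner_chart i x u v : dom i x -> inner x u v =
  dotG (metric i (chart i x)) (u *m jac (chart_at x) i x)
    (v *m jac (chart_at x) i x).
Proof.
move=> ix; rewrite /inner /coords /dotG.
rewrite (metric_compat (dom_chart_at x) ix) -/(jac _ _ _).
by rewrite trmx_mul !mulmxA.
Qed.

Lemma innerDl x u v w : inner x (u + v) w = inner x u w + inner x v w.
Proof. by rewrite /inner /dotG !mulmxDl mxE. Qed.

Lemma innerDr x u v w : inner x w (u + v) = inner x w u + inner x w v.
Proof. by rewrite /inner /dotG linearD /= mulmxDr mxE. Qed.

Lemma innerZl x a u w : inner x (a *: u) w = a * inner x u w.
Proof. by rewrite /inner /dotG -!scalemxAl mxE. Qed.

Lemma innerZr x a u w : inner x w (a *: u) = a * inner x w u.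
Proof. by rewrite /inner /dotG linearZ /= -scalemxAr mxE. Qed.

Lemma inner_sym x u v : inner x u v = inner x v u.
Proof.
have Ux : (chart (chart_at x) @` dom (chart_at x)) (coords x).
  by exists x => //; exact: dom_chart_at.
by rewrite /inner /dotG -[LHS]trmxE !trmx_mul trmxK mulmxA (Defs.metric_sym Ux).
Qed.

Variable T : R.
Hypothesis T0 : 0 < T.
Let I : set R := `[0, T]%classic.
Variable c : R -> M.
Implicit Types (t : R) (X Y : R -> 'rV[R]_n).

Lemma mem_segment t : 0 <= t <= T -> I t.
Proof. by rewrite /I /= in_itv. Qed.

Lemma curve_near_dom t : curve_derivable I c t ->
  \forall s \near within I (nbhs t), dom (chart_at (c t)) (c s).
Proof. by move=> [cc _]; apply: cc; exact: nbhs_dom (dom_chart_at _). Qed.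

Lemma vec_coords_self X t : vec_coords c X (chart_at (c t)) t = X t.
Proof. by rewrite /vec_coords jac_refl ?mulmx1 //; exact: dom_chart_at. Qed.

(** Compatibility of the connection with the metric, carried along the curve. Writing the derivative
    through the connection matrix lets [covD] absorb it later. *)
Lemma deriv_in_metric t : 0 <= t <= T -> curve_derivable I c t ->
  let G := metric (chart_at (c t)) in
  let C := conn (c t) (velocity I c t) in
  deriv_in I (fun s => G (chart (chart_at (c t)) (c s))) t
    (C *m G (coords (c t)) + G (coords (c t)) *m C^T).
Proof.
move=> tT ct G C; have ix := dom_chart_at (c t).
rewrite -(connG_metric _ (metric_differentiable ix) (metric_sym_near ix)
  (metric_unit ix)).
apply: (@deriv_in_comp _ _ _ (mem_segment tT) _ _ (chart (chart_at (c t)) \o c)).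
  exact: metric_differentiable.
by apply: derivable_inP => //; case: ct.
Qed.

Lemma deriv_in_inner X Y t : 0 <= t <= T ->
  field_derivable I c X t -> field_derivable I c Y t ->
  deriv_in I (fun s => inner (c s) (X s) (Y s)) t
    (inner (c t) (covD I c X t) (Y t) + inner (c t) (X t) (covD I c Y t)).
Proof.
move=> tT [ct dX] [_ dY]; have It := mem_segment tT.
set i := chart_at (c t).
pose P s := vec_coords c X i s *m metric i (chart i (c s)) *m (vec_coords c Y i s)^T.
have PE : \forall s \near within I (nbhs t), P s 0 0 = inner (c s) (X s) (Y s).
  by apply: filterS (curve_near_dom ct) => s is_; rewrite (inner_chart _ _ is_).
apply: deriv_in_near PE _ => //.
(* The product rule gives four terms; the two that come from the metric complete the derivatives of
   [X] and [Y] to covariant ones. *)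
have dP := deriv_in_mulmx It (deriv_in_mulmx It (derivable_inP T0 tT dX)
  (deriv_in_metric tT ct)) (deriv_in_trmx It (derivable_inP T0 tT dY)).
have := (deriv_in_mxP It _ _).1 dP 0 0; rewrite !vec_coords_self.
congr deriv_in; rewrite /inner /dotG /covD /coords.
have addE (A B : 'M[R]_1) : A 0 0 + B 0 0 = (A + B) 0 0 by rewrite mxE.
rewrite addE; congr (fun_of_matrix _ 0 0).
move: (conn _ _) (derive_in _ _ _) (derive_in _ _ _) => C dXt dYt.
rewrite [trmx (_ + _)]linearD /= trmx_mul !(mulmxDl, mulmxDr) !mulmxA.
by rewrite -!addrA; do 2![congr (_ + _)]; exact: addrC.
Qed.

(** Applied to [e1] and [V], it provides the two-vector field whose area is [v2]. *)
Lemma deriv_in_wedge X Y t : 0 <= t <= T ->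
  field_derivable I c X t -> field_derivable I c Y t ->
  let L := fun s => wedge (X s) (Y s) in
  bifield_derivable I c L t /\
  covD_bivec I c L t = wedge (covD I c X t) (Y t) + wedge (X t) (covD I c Y t).
Proof.
move=> tT [ct dX] [_ dY] L; have It := mem_segment tT.
have LE i : bivec_coords c L i = fun s =>
    (vec_coords c X i s)^T *m vec_coords c Y i s
    - (vec_coords c Y i s)^T *m vec_coords c X i s.
  apply/funext => s; rewrite /bivec_coords /vec_coords /L /wedge.
  by rewrite mulmxBr mulmxBl !trmx_mul !mulmxA.
have DX := derivable_inP T0 tT dX; have DY := derivable_inP T0 tT dY.
have dL := deriv_inB It (deriv_in_mulmx It (deriv_in_trmx It DX) DY)
  (deriv_in_mulmx It (deriv_in_trmx It DY) DX).
have [cL DL] := deriv_in_derive T0 tT dL.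
split; first by split; [exact: ct | rewrite LE; exact: cL].
rewrite /covD_bivec LE DL !vec_coords_self /covD -/I.
move: (conn _ _) (derive_in _ _ _) (derive_in _ _ _) => C X' Y'.
rewrite /L /wedge ![trmx (_ + _)]linearD /= !trmx_mul.
rewrite !(mulmxDl, mulmxDr, mulmxN, mulNmx) !mulmxA.
have oppE (A : 'M[R]_n) k l : (- A) k l = - A k l by rewrite mxE.
by apply/matrixP => k l; rewrite !(addmxE, oppE); ring.
Qed.

End CovariantDerivative.

(** * The area form and its derivative along a curve *)

Section AreaForm.
Variables (R : realType) (M : orientedRiemannian R 2).
Implicit Types (x : M) (i : atlas M) (u v : 'rV[R]_2) (L : 'M[R]_2).

(* The Riemannian area form, in the antisymmetric-matrix encoding of
   two-vectors. *)
Definition bivec_area x L : R :=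
  Num.sqrt (\det (metric (chart_at x) (coords x))) * L 0 1.

Lemma metric_det_gt0 i x : dom i x -> 0 < \det (metric i (chart i x)).
Proof.
move=> ix; have xi : (chart i @` dom i) (chart i x) by exists x.
by apply: posdef_det_gt0; [exact: Defs.metric_sym | exact: metric_posdef].
Qed.

(** Antisymmetric matrices of size 2 form a line, on which congruence by [J] can only act by a
    scalar. *)
Lemma antisym_congr L (J : 'M[R]_2) : L^T = - L ->
  (J^T *m L *m J) 0 1 = \det J * L 0 1.
Proof.
move=> aL; have E k l : L l k = - L k l by move/matrixP : aL => /(_ k l); rewrite !mxE.
have L0 k : L k k = 0 by apply/eqP; rewrite -eqNr -E.
rewrite !mulmx2E !L0 (E 0 1) det_mx2 ![J^T _ _]mxE; ring.
Qed.

(** A change of chart affects the square root by [|det J|] and the entry of the two-vector by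
    [det J]. Transition maps preserve the orientation, so [det J > 0] and the two effects cancel. *)
Lemma bivec_area_chart i x L : dom i x -> L^T = - L ->
  let J := jac (chart_at x) i x in
  bivec_area x L =
    Num.sqrt (\det (metric i (chart i x))) * (J^T *m L *m J) 0 1.
Proof.
move=> ix aL J; rewrite antisym_congr // /bivec_area /coords.
rewrite (metric_compat (dom_chart_at x) ix) -/(jac _ _ _) -/J.
rewrite !det_mulmx det_tr.
have J0 : 0 < \det J := transition_oriented (dom_chart_at x) ix.
rewrite mulrAC -expr2 sqrtrM ?sqr_ge0 // sqrtr_sqr gtr0_norm //; ring.
Qed.

Variable T : R.
Hypothesis T0 : 0 < T.
Let I : set R := `[0, T]%classic.
Variable c : R -> M.

(** The area form is parallel: with connection matrix [C], the square root of [det G] has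
    logarithmic derivative [tr C], and [C^T L + L C = (tr C) L] for antisymmetric [L] in dimension
    two. *)
Lemma deriv_in_bivec_area (L : R -> 'M[R]_2) t : 0 <= t <= T ->
  (forall s, 0 <= s <= T -> (L s)^T = - L s) ->
  bifield_derivable I c L t ->
  deriv_in I (fun s => bivec_area (c s) (L s)) t
    (bivec_area (c t) (covD_bivec I c L t)).
Proof.
move=> tT aL [ct dL]; have It := mem_segment tT.
set i := chart_at (c t).
pose P s := Num.sqrt (\det (metric i (chart i (c s)))) * bivec_coords c L i s 0 1.
have PE : \forall s \near within I (nbhs t), P s = bivec_area (c s) (L s).
  near=> s; rewrite (@bivec_area_chart i) //.
    by near: s; exact: curve_near_dom.
  by apply: aL; have : I s by [near: s; exact: withinT]; rewrite /I /= in_itv.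
apply: deriv_in_near PE _ => //.
have dG := (deriv_in_mxP It _ _).1 (deriv_in_metric T0 tT ct).
(* Jacobi's formula for [G' = C G + G C^T]; each of the two terms contributes [tr C]. *)
have ddet : deriv_in I (fun s => \det (metric i (chart i (c s)))) t
    (2 * \tr (conn (c t) (velocity I c t)) * \det (metric i (chart i (c t)))).
  under eq_fun do rewrite det_mx2.
  have := deriv_inB It (deriv_inM It (dG 0 0) (dG 1 1)) (deriv_inM It (dG 0 1) (dG 1 0)).
  congr deriv_in; rewrite /coords -/i [RHS]mulrC det_mx2 /mxtrace sum_ord2.
  rewrite -/I; move: (conn _ _) => C; rewrite !addmxE !mulmx2E !trmxE.
  have : metric i (chart i (c t)) 1 0 = metric i (chart i (c t)) 0 1.
    rewrite -[in LHS](@Defs.metric_sym _ _ M i) ?mxE //.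
    exists (c t) => //; exact: dom_chart_at.
  by move=> ->; ring.
have d0 : 0 < \det (metric i (chart i (c t))).
  by apply: metric_det_gt0; exact: dom_chart_at.
have dS := deriv_in_comp1 It (is_derive1_sqrt d0) ddet.
have dL01 := (deriv_in_mxP It _ _).1 (derivable_inP T0 tT dL) 0 1.
have := deriv_inM It dS dL01; congr deriv_in.
rewrite /covD_bivec /bivec_area -/i /coords -/i /=.
have s0 : Num.sqrt (\det (metric i (chart i (c t)))) != 0.
  by rewrite gt_eqF // sqrtr_gt0.
have -> : bivec_coords c L i t = L t.
  by rewrite /bivec_coords jac_refl ?trmx1 ?mul1mx ?mulmx1 //; exact: dom_chart_at.
have E k l : L t l k = - L t k l.
  by move/matrixP : (aL _ tT) => /(_ k l); rewrite !mxE.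
have L0 k : L t k k = 0 by apply/eqP; rewrite -eqNr -E.
rewrite -/I; move: (conn _ _) => C.
rewrite !addmxE !mulmx2E !L0 !trmxE.
(* [det G] is written as the square of its root, so that [field] can cancel the root in the
   denominator. *)
rewrite -[in X in X * _ * _](sqr_sqrtr (ltW d0)) /mxtrace sum_ord2.
by field.
Unshelve. all: by end_near. Qed.

End AreaForm.

(** * Continuously differentiable maps *)

Section C1.
Variables (R : realType) (V : normedModType R).
Implicit Types (U : set V) (W : normedModType R).

Lemma near_eq_continuous W (f g : V -> W) p :
  {near p, f =1 g} -> {for p, continuous f} -> {for p, continuous g}.
Proof.
move=> fg; rewrite /prop_for /continuous_at -(nbhs_singleton fg).
by apply: cvg_trans; apply: near_eq_cvg; apply: filterS fg => q /esym.
Qed.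

(** ['d f p] is continuous and linear and also approximates [g] to first order, so [diff_unique]
    identifies it with the differential of [g]. *)
Lemma near_eq_differentiable W (f g : V -> W) p :
  {near p, f =1 g} -> differentiable f p -> differentiable g p.
Proof.
move=> fg df; have cdf : continuous ('d f p) by exact: diff_continuous.
have H : g \o shift p = cst (g p) + 'd f p +o_ 0 id.
  apply/eqaddoP => e e0; have /eqaddoP/(_ e e0) := diff_locally df.
  have fg0 : \forall h \near 0, f (h + p) = g (h + p).
    by move: fg; rewrite (near_shift 0) => fg; apply: filterS fg => q /=; rewrite subr0.
  apply: filter_app; apply: filterS fg0 => h /= fgh.
  by rewrite -!/(_ + _) /= !fctE /= -fgh (nbhs_singleton fg).
by apply/diff_locallyP; rewrite (diff_unique cdf H).
Qed.

Lemma open_near U p (P : V -> Prop) : open U -> U p -> (forall q, U q -> P q) ->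
  \forall q \near p, P q.
Proof. by move=> oU Up H; apply: filterS H _; exact: open_nbhs_nbhs. Qed.

Lemma C1_eq W U (f g : V -> W) : open U -> (forall p, U p -> f p = g p) ->
  smooth_upto 1 U f -> smooth_upto 1 U g.
Proof.
move=> oU fg [df cf]; have fgp p : U p -> {near p, f =1 g}.
  by move=> Up; apply: open_near fg.
split=> [p Up|v p Up].
  by apply: near_eq_differentiable (fgp _ Up) (df _ Up).
apply: near_eq_continuous (cf v p Up).
by apply: (open_near oU Up) => q Uq; apply: near_eq_derive; exact: fgp.
Qed.

Lemma C1_continuous W U (f : V -> W) : smooth_upto 1 U f ->
  forall p, U p -> {for p, continuous f}.
Proof. by move=> [df _] p Up; apply: differentiable_continuous; exact: df. Qed.

Lemma C1_cst W U (a : W) : smooth_upto 1 U (fun=> a).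
Proof.
split=> [p _|v p _]; first exact: differentiable_cst.
apply: (@near_eq_continuous _ (cst 0)); last exact: cst_continuous.
by apply: nearW => q; apply/esym; exact: derive_cst.
Qed.

Lemma C1D W U (f g : V -> W) : open U -> smooth_upto 1 U f ->
  smooth_upto 1 U g -> smooth_upto 1 U (fun p => f p + g p).
Proof.
move=> oU [df cf] [dg cg]; split=> [p Up|v p Up].
  by apply: differentiableD; [exact: df | exact: dg].
apply: (@near_eq_continuous _ (fun q => 'D_v f q + 'D_v g q)).
  apply: (open_near oU Up) => q Uq; apply/esym.
  by apply: deriveD; apply: diff_derivable; [exact: df | exact: dg].
by apply: cvgD; [exact: cf | exact: cg].
Qed.

Lemma C1M U (f g : V -> R) : open U -> smooth_upto 1 U f ->
  smooth_upto 1 U g -> smooth_upto 1 U (fun p => f p * g p).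
Proof.
move=> oU [df cf] [dg cg]; split=> [p Up|v p Up].
  by apply: differentiableM; [exact: df | exact: dg].
apply: (@near_eq_continuous _ (fun q => f q * 'D_v g q + g q * 'D_v f q)).
  apply: (open_near oU Up) => q Uq; apply/esym.
  by apply: deriveM; apply: diff_derivable; [exact: df | exact: dg].
have [cf0 cg0] : {for p, continuous f} /\ {for p, continuous g}.
  by split; apply: differentiable_continuous; [exact: df | exact: dg].
by apply: cvgD; apply: cvgM => //; [exact: cg | exact: cf].
Qed.

Lemma C1V U (f : V -> R) : open U -> (forall p, U p -> f p != 0) ->
  smooth_upto 1 U f -> smooth_upto 1 U (fun p => (f p)^-1).
Proof.
move=> oU f0 [df cf]; split=> [p Up|v p Up].
  by apply: differentiableV; [exact: df | exact: f0].
apply: (@near_eq_continuous _ (fun q => - (f q)^-1 ^+ 2 * 'D_v f q)).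
  apply: (open_near oU Up) => q Uq; apply/esym.
  have dq : derivable f q v by apply: diff_derivable; exact: df.
  apply: etrans (deriveV (f0 _ Uq) dq) _.
  by rewrite /GRing.scale /= exprVn.
have cf0 : {for p, continuous f}.
  by apply: differentiable_continuous; exact: df.
apply: cvgM; last exact: cf.
apply: cvgN; apply: cvgM; apply: cvgV => //; exact: f0.
Qed.

Lemma C1_sum W U (J : Type) (r : seq J) (F : J -> V -> W) : open U ->
  (forall j, smooth_upto 1 U (F j)) ->
  smooth_upto 1 U (fun p => \sum_(j <- r) F j p).
Proof.
move=> oU HF; elim: r => [|j r IH].
  by under eq_fun do rewrite big_nil; exact: C1_cst.
by under eq_fun do rewrite big_cons; exact: (C1D oU (HF j) IH).
Qed.

Lemma C1_prod U (J : Type) (r : seq J) (F : J -> V -> R) : open U ->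
  (forall j, smooth_upto 1 U (F j)) ->
  smooth_upto 1 U (fun p => \prod_(j <- r) F j p).
Proof.
move=> oU HF; elim: r => [|j r IH].
  by under eq_fun do rewrite big_nil; exact: C1_cst.
by under eq_fun do rewrite big_cons; exact: (C1M oU (HF j) IH).
Qed.

Lemma C1Zl W U (f : V -> R) (a : W) : open U -> smooth_upto 1 U f ->
  smooth_upto 1 U (fun p => f p *: a).
Proof.
move=> oU [df cf]; split=> [p Up|v p Up].
  by apply: differentiableZl; exact: df.
apply: (@near_eq_continuous _ (fun q => 'D_v f q *: a)).
  apply: (open_near oU Up) => q Uq.
  have d1 : differentiable (fun q => f q *: a) q.
    by apply: differentiableZl; exact: df.
  by rewrite (deriveE v d1) (deriveE v (df _ Uq)) (diffZl a (df _ Uq)).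
by apply: cvgZ; [exact: cf | exact: cvg_cst].
Qed.

Lemma C1_mx U m n (A : V -> 'M[R]_(m, n)) : open U ->
  (forall i j, smooth_upto 1 U (fun p => A p i j)) -> smooth_upto 1 U A.
Proof.
move=> oU HA.
have -> : A = fun p => \sum_i \sum_j A p i j *: delta_mx i j.
  by apply/funext => p; rewrite [LHS]matrix_sum_delta.
by apply: C1_sum => // i; apply: C1_sum => // j; exact: C1Zl.
Qed.

Lemma C1_coord U m n (A : V -> 'M[R]_(m, n)) i j : open U ->
  smooth_upto 1 U A -> smooth_upto 1 U (fun p => A p i j).
Proof.
move=> oU [dA cA]; split=> [p Up|v p Up].
  apply: (@differentiable_comp _ _ _ _ A (fun B : 'M[R]_(m, n) => B i j)).
    exact: dA.
  exact: differentiable_coord.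
apply: (@near_eq_continuous _ (fun q => 'D_v A q i j)).
  apply: (open_near oU Up) => q Uq.
  by rewrite derive_mx ?mxE //; apply: diff_derivable; exact: dA.
apply: (@continuous_comp _ _ _ ('D_v A) (fun B : 'M[R]_(m, n) => B i j)).
  exact: cA.
exact: coord_continuous.
Qed.

Lemma C1_mulmx U m n k (A : V -> 'M[R]_(m, n)) (B : V -> 'M[R]_(n, k)) :
  open U -> smooth_upto 1 U A -> smooth_upto 1 U B ->
  smooth_upto 1 U (fun p => A p *m B p).
Proof.
move=> oU HA HB; apply: C1_mx => // i j; under eq_fun do rewrite mxE.
by apply: C1_sum => // l; apply: C1M => //; exact: C1_coord.
Qed.

Lemma C1_det U n (A : V -> 'M[R]_n) : open U ->
  (forall i j, smooth_upto 1 U (fun p => A p i j)) ->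
  smooth_upto 1 U (fun p => \det (A p)).
Proof.
move=> oU HA; apply: C1_sum => // s; apply: C1M => //; first exact: C1_cst.
exact: C1_prod.
Qed.

(** Cramer's formula writes the inverse through determinants of minors and the reciprocal of the
    determinant. It agrees with [invmx] where the matrix is invertible, hence the passage through
    [C1_eq] on [U]. *)
Lemma C1_invmx U n (A : V -> 'M[R]_n) : open U ->
  (forall p, U p -> A p \in unitmx) -> smooth_upto 1 U A ->
  smooth_upto 1 U (fun p => invmx (A p)).
Proof.
move=> oU uA HA.
have E p : U p -> (\det (A p))^-1 *: \adj (A p) = invmx (A p).
  by move=> /uA uAp; rewrite /invmx uAp.
apply: (C1_eq oU E).
have HA' i j : smooth_upto 1 U (fun p => A p i j) by exact: C1_coord.
apply: (C1_mx oU) => i j.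
have -> : (fun p => ((\det (A p))^-1 *: \adj (A p)) i j) =
    (fun p => (\det (A p))^-1 * ((-1) ^+ (j + i) * \det (row' j (col' i (A p))))).
  by apply/funext => p; rewrite mxE [\adj _ _ _]mxE.
apply: (C1M oU).
  apply: (C1V oU); last exact: C1_det.
  by move=> p /uA; rewrite unitmxE unitfE.
apply: (C1M oU); first exact: C1_cst.
by apply: (C1_det oU) => k l; under eq_fun do rewrite mxE mxE.
Qed.

End C1.

(** * Curvature *)

Section Curvature.
Variables (R : realType) (n : nat).
Implicit Types (G : 'rV[R]_n -> 'M[R]_n) (p u v w : 'rV[R]_n).

Lemma connG_is_linear G p a u v : differentiable G p ->
  connG G p (a *: u + v) = a *: connG G p u + connG G p v.
Proof.
move=> dG; rewrite /connG scalemxAl -mulmxDl; congr (_ *m _).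
rewrite scalerA mulrC -scalerA -scalerDr; congr (_ *: _).
have -> : 'D_(a *: u + v) G p = a *: 'D_u G p + 'D_v G p.
  by rewrite !deriveE // linearP.
move: ('D_u G p) ('D_v G p) => A A'; pose B j := 'D_(ev R j) G p.
suff H : (\matrix_(j, k) ((a *: A + A') j k + ((a *: u + v) *m B j) 0 k
      - ((a *: u + v) *m B k) 0 j) : 'M[R]_n) =
    a *: (\matrix_(j, k) (A j k + (u *m B j) 0 k - (u *m B k) 0 j))
    + \matrix_(j, k) (A' j k + (v *m B j) 0 k - (v *m B k) 0 j) by exact: H.
move: B => B; apply/matrixP => j k.
have E (X : 'I_n -> 'I_n -> R) : (\matrix_(j, k) X j k) j k = X j k by rewrite mxE.
have Z (X : 'M[R]_n) : (a *: X) j k = a * X j k by rewrite mxE.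
rewrite E [RHS]addmxE Z !E !mulmxDl -!scalemxAl.
move: (u *m B j) (u *m B k) (v *m B j) (v *m B k) => uj uk vj vk.
by rewrite !mxE; ring.
Qed.

Lemma connG0 G p : differentiable G p -> connG G p 0 = 0.
Proof.
move=> dG; have := connG_is_linear 0 0 0 dG.
by rewrite scale0r addr0 scale0r add0r => /eqP; rewrite -subr_eq0 => _;
   have := connG_is_linear (-1) 0 0 dG; rewrite scaler0 addr0 scaleN1r addNr.
Qed.

(** Fields that are constant in the chart have zero bracket and zero derivatives, which leaves the
    derivatives of the connection matrices and their commutator. *)
Lemma curvGE G p u v w : differentiable G p -> curvG G p u v w =
  'D_u (fun q => w *m connG G q v) p + w *m connG G p v *m connG G p u
  - ('D_v (fun q => w *m connG G q u) p + w *m connG G p u *m connG G p v).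
Proof.
move=> dG.
have E v' : nablaG G (fun=> v') (fun=> w) = fun q => w *m connG G q v'.
  apply/funext => q; rewrite /nablaG.
  by rewrite (_ : 'D_v' (fun=> w) q = 0) ?add0r //; exact: derive_cst.
rewrite /curvG /riemannG !E {1 2}/nablaG.
have -> : lie_bracket (fun=> u) (fun=> v) = fun=> 0.
  apply/funext => q; rewrite /lie_bracket.
  rewrite (_ : 'D_u (fun=> v) q = 0); last exact: derive_cst.
  by rewrite (_ : 'D_v (fun=> u) q = 0) ?subr0 //; exact: derive_cst.
by rewrite E connG0 // mulmx0 subr0.
Qed.

Lemma curvG_antisym G p u v w : differentiable G p ->
  curvG G p u v w = - curvG G p v u w.
Proof. by move=> dG; rewrite !curvGE // opprB. Qed.

(** The vector [u] enters the derivative terms in two ways: as the direction of differentiation, and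
    inside a differentiated connection matrix. The second needs linearity of [connG] at all points
    near [p], hence the open set [U]. *)
Lemma curvG_linear_l G (U : set 'rV[R]_n) p a u u' v w : open U -> U p ->
  smooth_upto 1 U G -> (forall u, smooth_upto 1 U (connG G ^~ u)) ->
  curvG G p (a *: u + u') v w = a *: curvG G p u v w + curvG G p u' v w.
Proof.
move=> oU Up [dG _] dC; have dGp := dG p Up.
rewrite !curvGE //.
have df v' : differentiable (fun q => w *m connG G q v') p.
  have [+ _] := C1_mulmx oU (C1_cst U w) (dC v'); exact.
have -> : 'D_(a *: u + u') (fun q => w *m connG G q v) p =
    a *: 'D_u (fun q => w *m connG G q v) p
    + 'D_u' (fun q => w *m connG G q v) p.
  by rewrite !deriveE // linearP.
have -> : 'D_v (fun q => w *m connG G q (a *: u + u')) p =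
    a *: 'D_v (fun q => w *m connG G q u) p
    + 'D_v (fun q => w *m connG G q u') p.
  rewrite -deriveZ; last exact: diff_derivable.
  rewrite -deriveD; last 2 first.
  - by apply: derivableZ; exact: diff_derivable.
  - exact: diff_derivable.
  apply: near_eq_derive; apply: (open_near oU Up) => q Uq.
  by rewrite (connG_is_linear a u u' (dG q Uq)) mulmxDr -scalemxAr.
rewrite (connG_is_linear a u u' dGp).
move: ('D_u _ p) ('D_u' _ p) ('D_v _ p) ('D_v _ p) => A A' B B'.
move: (connG G p u) (connG G p u') (connG G p v) => Cu Cu' Cv.
rewrite !(mulmxDr, mulmxDl) -!scalemxAr -!scalemxAl.
move: (w *m Cv *m Cu) (w *m Cv *m Cu') (w *m Cu *m Cv) (w *m Cu' *m Cv).
by move=> E E' H H'; apply/rowP => k; rewrite !mxE; ring.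
Qed.

End Curvature.

(** * Alternating bilinear maps on the plane *)

Section AlternatingPlane.
Variables (R : realType) (W : lmodType R).
Variable F : 'rV[R]_2 -> 'rV[R]_2 -> W.
Hypothesis Flin : forall a u u' v, F (a *: u + u') v = a *: F u v + F u' v.
Hypothesis Falt : forall u v, F u v = - F v u.

Lemma alternating_diag u : F u u = 0.
Proof.
apply/eqP; have /eqP := Falt u u.
by rewrite -subr_eq0 opprK -mulr2n -scaler_nat scaler_eq0 pnatr_eq0.
Qed.

Lemma row2E (u : 'rV[R]_2) : u = u 0 0 *: ev R 0 + u 0 1 *: ev R 1.
Proof. by rewrite [LHS]row_sum_delta sum_ord2. Qed.

(** Linearity in the second argument follows from [Falt]; after expansion in the basis only the
    mixed terms survive. *)
Lemma alternating_det2 u v : F u v = det2 u v *: F (ev R 0) (ev R 1).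
Proof.
have Flin0 a u' v' : F (a *: u') v' = a *: F u' v'.
  have F0 : F 0 v' = 0.
    have := Flin (-1) 0 0 v'.
    by rewrite scaler0 addr0 scaleN1r addNr.
  by have := Flin a u' 0 v'; rewrite addr0 F0 addr0.
have H i x : F (ev R i) x = x 0 0 *: F (ev R i) (ev R 0) + x 0 1 *: F (ev R i) (ev R 1).
  by rewrite Falt [in LHS](row2E x) Flin Flin0 opprD -!scalerN -!Falt.
rewrite [in LHS](row2E u) Flin Flin0 (H 0) (H 1) !alternating_diag.
rewrite (Falt (ev R 1)) !scaler0 add0r addr0 !scalerN !scalerA.
by rewrite -scalerBl.
Qed.

(** The double sum meets the basis two-vector twice, as (0, 1) and as (1, 0) with both signs
    reversed; the factor 1/2 undoes this. It reduces [on_bivector] to a single curvature value. *)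
Lemma on_bivector_wedge a u v :
  2^-1 *: (\sum_(r < 2) \sum_(s < 2) (a *: wedge u v) r s *: F (ev R r) (ev R s))
  = a *: F u v.
Proof.
rewrite !sum_ord2 !alternating_diag !scaler0 add0r addr0 (Falt (ev R 1)).
rewrite scalerN -scalerBl scalerA [in RHS]alternating_det2 scalerA.
by congr (_ *: _); rewrite /wedge /det2 !mxE !big_ord1 !mxE; field.
Qed.

End AlternatingPlane.

Section ChartCurvature.
Variables (R : realType) (n : nat) (M : orientedRiemannian R n).
Implicit Types (i : atlas M) (u v w : 'rV[R]_n).

Lemma metric_C1 i : smooth_upto 1 (chart i @` dom i) (metric i).
Proof. exact: (@metric_smooth _ _ M i 1). Qed.

(** Koszul's formula contains first derivatives of the metric, so smoothness of order 2 leaves one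
    order for the connection. *)
Lemma connG_C1 i u :
  smooth_upto 1 (chart i @` dom i) (connG (metric i) ^~ u).
Proof.
have oU : open (chart i @` dom i) := @img_open _ _ M i.
have [_ DG] := @metric_smooth _ _ M i 2.
apply: (C1_mulmx oU); last first.
  apply: (C1_invmx oU); last exact: metric_C1.
  by move=> _ [x ix <-]; exact: metric_unit.
have DuC m (A : 'M[R]_(m, n)) v l k : smooth_upto 1 (chart i @` dom i)
    (fun p => (A *m 'D_v (metric i) p) l k).
  apply: (C1_coord _ _ oU); apply: (C1_mulmx oU); [exact: C1_cst | exact: DG].
have Z (a : R) (X : 'M[R]_n) j k : (a *: X) j k = a * X j k by rewrite mxE.
have E (X : 'I_n -> 'I_n -> R) j k : (\matrix_(j, k) X j k) j k = X j k.
  by rewrite mxE.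
apply: (C1_mx oU) => j k; under eq_fun do rewrite Z E -mulN1r.
apply: (C1M oU); first exact: C1_cst.
apply: (C1D oU); last by apply: (C1M oU); [exact: C1_cst | exact: DuC].
by apply: (C1D oU); [apply: (C1_coord _ _ oU); exact: DG | exact: DuC].
Qed.

Lemma curvG_continuous i p u v w : (chart i @` dom i) p ->
  {for p, continuous (fun q => curvG (metric i) q u v w)}.
Proof.
have oU : open (chart i @` dom i) := @img_open _ _ M i.
move=> Up; have [dG _] := metric_C1 i.
have C1wC v' : smooth_upto 1 (chart i @` dom i) (fun q => w *m connG (metric i) q v').
  by apply: (C1_mulmx oU); [exact: C1_cst | exact: connG_C1].
have C1wCC v' u' : {for p, continuous (fun q =>
    w *m connG (metric i) q v' *m connG (metric i) q u')}.
  apply: C1_continuous Up; apply: (C1_mulmx oU) => //; exact: connG_C1.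
pose D u' v' q := 'D_u' (fun q' => w *m connG (metric i) q' v') q
  + w *m connG (metric i) q v' *m connG (metric i) q u'.
apply: (@near_eq_continuous _ _ _ (fun q => D u v q - D v u q)).
  by apply: (open_near oU Up) => q Uq; apply/esym; apply: curvGE; exact: dG.
have cD u' v' : {for p, continuous (D u' v')}.
  have [_ c] := C1wC v'.
  exact: (@continuousD _ _ _ _ _ p (c u' p Up) (C1wCC v' u')).
exact: (@continuousB _ _ _ _ _ p (cD u v) (cD v u)).
Qed.

Lemma curv_linear_l (x : M) a u u' v w :
  curv x (a *: u + u') v w = a *: curv x u v w + curv x u' v w.
Proof.
apply: (curvG_linear_l a u u' v w (@img_open _ _ M (chart_at x))).
- by exists x => //; exact: dom_chart_at.
- exact: metric_C1.
- exact: connG_C1.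
Qed.

Lemma curv_antisym (x : M) u v w : curv x u v w = - curv x v u w.
Proof. by apply: curvG_antisym; apply: metric_differentiable; exact: dom_chart_at. Qed.

End ChartCurvature.

(** * Gaussian curvature: values on a frame and continuity *)

Section GaussianCurvature.
Variables (R : realType) (M : orientedRiemannian R 2) (K : M -> R).
Hypothesis hK : gaussian_curvature K.
Implicit Types (x : M) (i : atlas M) (u v w : 'rV[R]_2).

Lemma gaussian_curvatureE x u v : inner x (curv x u v v) u =
  K x * (inner x u u * inner x v v - inner x u v ^+ 2).
Proof. exact: hK (dom_chart_at x) u v. Qed.

(* Replacing u by u + v changes neither R(u, v)v nor the Gram determinant. *)
Lemma curv_orth x u v : inner x (curv x u v v) v = 0.
Proof.
have vv : curv x v v v = 0.
  by apply: (alternating_diag (F := fun u v' => curv x u v' v)) => *;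
    exact: curv_antisym.
have := gaussian_curvatureE x (1 *: u + v) v.
rewrite curv_linear_l vv addr0 !scale1r.
move: (curv x u v v) (gaussian_curvatureE x u v) => r ru.
rewrite !(innerDr, innerDl) ru (inner_sym x v u) => H.
rewrite -[LHS](addKr (K x * (inner x u u * inner x v v - inner x u v ^+ 2))) H.
ring.
Qed.

(** The known identities concern [R(u, v) v]; since [R(u, v) u = - R(v, u) u], they apply with [u]
    and [v] exchanged. *)
Lemma curv_orthonormal x u v : inner x u u = 1 -> inner x u v = 0 ->
  inner x v v = 1 ->
  inner x (curv x u v u) u = 0 /\ inner x (curv x u v u) v = - K x.
Proof.
move=> uu uv vv.
rewrite (curv_antisym x u) -scaleN1r !innerZl curv_orth gaussian_curvatureE.
by rewrite (inner_sym x v u) uu uv vv; split; ring.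
Qed.

(** In a fixed chart [K] is the quotient of [<R(e_0, e_1) e_1, e_0>] by the positive determinant
    [det G], both continuous in the coordinates. *)
Lemma gaussian_curvature_continuous : continuous K.
Proof.
move=> x; pose i := chart_at x.
have ix : dom i x := dom_chart_at x.
have oU : open (chart i @` dom i) := @img_open _ _ M i.
have Ux : (chart i @` dom i) (chart i x) by exists x.
pose r p k := curvG (metric i) p (ev R 0) (ev R 1) (ev R 1) 0 k.
pose Kc p := (r p 0 * metric i p 0 0 + r p 1 * metric i p 1 0)
  * (\det (metric i p))^-1.
have C1G k l : smooth_upto 1 (chart i @` dom i) (fun p => metric i p k l).
  by apply: (C1_coord _ _ oU); exact: metric_C1.
have cG k l := C1_continuous (C1G k l) Ux.
have cV : {for chart i x, continuous (fun p => (\det (metric i p))^-1)}.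
  apply: C1_continuous Ux; apply: (C1V oU); last exact: (C1_det oU).
  by move=> _ [y iy <-]; rewrite gt_eqF // metric_det_gt0.
have cr k : {for chart i x, continuous (r ^~ k)}.
  apply: (@continuous_comp _ _ _
    (fun p => curvG (metric i) p (ev R 0) (ev R 1) (ev R 1))
    (fun r : 'rV[R]_2 => r 0 k)); first exact: curvG_continuous.
  exact: coord_continuous.
have cKc : {for chart i x, continuous Kc} := continuousM
  (continuousD (continuousM (cr 0) (cG 0 0)) (continuousM (cr 1) (cG 1 0))) cV.
have KE : {near x, Kc \o chart i =1 K}.
  apply: filterS (nbhs_dom ix) => y iy; rewrite /= /Kc.
  have Uy : (chart i @` dom i) (chart i y) by exists y.
  have := hK iy (ev R 0) (ev R 1); rewrite /= !dotGE det_mx2.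
  rewrite -[curvG _ _ _ _ _ 0 0]/(r (chart i y) 0).
  rewrite -[curvG _ _ _ _ _ 0 1]/(r (chart i y) 1).
  have -> : ev R (0 : 'I_2) 0 0 = 1 :> R by rewrite mxE.
  have -> : ev R (0 : 'I_2) 0 1 = 0 :> R by rewrite mxE.
  have -> : ev R (1 : 'I_2) 0 0 = 0 :> R by rewrite mxE.
  have -> : ev R (1 : 'I_2) 0 1 = 1 :> R by rewrite mxE.
  rewrite !(mulr0, mul0r, mulr1, mul1r, addr0, add0r).
  have S : metric i (chart i y) 1 0 = metric i (chart i y) 0 1.
    by rewrite -[in LHS](Defs.metric_sym Uy) mxE.
  have := metric_det_gt0 iy; rewrite det_mx2 S => d0.
  have D0 : metric i (chart i y) 0 0 * metric i (chart i y) 1 1 -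
    metric i (chart i y) 0 1 * metric i (chart i y) 0 1 != 0 by rewrite gt_eqF.
  by rewrite -expr2 in D0 * => ->; rewrite mulfK.
have : (Kc \o chart i) @ x --> Kc (chart i x).
  by apply: continuous_comp => //; exact: chart_continuous.
rewrite -[Kc (chart i x)]/((Kc \o chart i) x) (nbhs_singleton KE).
by apply: cvg_trans; apply: near_eq_cvg; apply: filterS KE => y /esym.
Qed.

End GaussianCurvature.

(** * The moving frame *)

Section Frame.
Variables (R : realType) (M : orientedRiemannian R 2).
Implicit Types (x : M) (u v w : 'rV[R]_2).

Lemma bivec_areaZ x a L : bivec_area x (a *: L) = a * bivec_area x L.
Proof. by rewrite /bivec_area mxE mulrCA. Qed.

Lemma bivec_areaD x L L' :
  bivec_area x (L + L') = bivec_area x L + bivec_area x L'.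
Proof. by rewrite /bivec_area mxE mulrDr. Qed.

Lemma wedge_antisym n (u v : 'rV[R]_n) : (wedge u v)^T = - wedge u v.
Proof. by rewrite /wedge linearB /= !trmx_mul !trmxK opprB. Qed.

Lemma wedge_det2 u v : wedge u v 0 1 = det2 u v.
Proof. by rewrite /wedge /det2 !mxE !big_ord1 !mxE; ring. Qed.

Lemma gram_det2 x u v : inner x u u * inner x v v - inner x u v ^+ 2 =
  det2 u v ^+ 2 * \det (metric (chart_at x) (coords x)).
Proof.
have Ux : (chart (chart_at x) @` dom (chart_at x)) (coords x).
  by exists x => //; exact: dom_chart_at.
rewrite /inner !dotGE det_mx2 /det2.
have -> : metric (chart_at x) (coords x) 1 0 = metric (chart_at x) (coords x) 0 1.
  by rewrite -[in LHS](Defs.metric_sym Ux) mxE.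
ring.
Qed.

Section Orthonormal.
Variables (x : M) (u v : 'rV[R]_2).
Hypothesis uv : pos_orthonormal x u v.

(** The Gram determinant is 1, so the area is 1 or -1; the positive coordinate determinant excludes
    -1. *)
Lemma pos_orthonormal_area : bivec_area x (wedge u v) = 1.
Proof.
case: uv => uu uv0 vv; rewrite det_col_mx /bivec_area wedge_det2 => d0.
have := gram_det2 x u v; rewrite uu uv0 vv expr0n subr0 mulr1.
have g0 := ltW (metric_det_gt0 (dom_chart_at x)).
rewrite -[X in _ * X](sqr_sqrtr g0) -exprMn => /esym/eqP.
rewrite sqrf_eq1 mulrC => /orP[/eqP //|/eqP E].
have : 0 <= Num.sqrt (\det (metric (chart_at x) (coords x))) * det2 u v.
  by rewrite mulr_ge0 ?sqrtr_ge0 // ltW.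
by rewrite E oppr_ge0 ler10.
Qed.

Lemma pos_orthonormal_expand w : w = inner x w u *: u + inner x w v *: v.
Proof.
case: uv => uu uv0 vv; rewrite det_col_mx => d0.
have dn0 : det2 u v != 0 by rewrite gt_eqF.
have [a [b ->]] : exists a b, w = a *: u + b *: v.
  (* The coefficients are those of Cramer's rule. *)
  exists (det2 w v / det2 u v), (det2 u w / det2 u v).
  apply/rowP; apply: forall_ord2; rewrite !mxE; move: dn0; rewrite /det2 => ?;
    by field.
rewrite !innerDl !innerZl uu (inner_sym x v u) uv0 vv.
by rewrite !mulr1 !mulr0 addr0 add0r.
Qed.

Lemma bivec_area_frame a b c d :
  bivec_area x (wedge (a *: u + b *: v) (c *: u + d *: v)) = a * d - b * c.
Proof.
rewrite -[RHS]mulr1 -pos_orthonormal_area -bivec_areaZ.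
rewrite bivec_areaZ /bivec_area !wedge_det2 /det2 !mxE; ring.
Qed.

Lemma curv_frame (K : M -> R) : gaussian_curvature K ->
  curv x u v u = - K x *: v.
Proof.
case: (uv) => uu uv0 vv _ hK.
have [c0 c1] := curv_orthonormal hK uu uv0 vv.
by rewrite [LHS]pos_orthonormal_expand c0 c1 scale0r add0r.
Qed.

End Orthonormal.
End Frame.

Section RollingCurvature.
Variables (R : realType) (M Mh : orientedRiemannian R 2) (q : config M Mh).

Lemma iso_unit : iso q \in unitmx.
Proof. by rewrite unitmxE unitfE gt_eqF // iso_oriented. Qed.

Lemma iso_pos_orthonormal u v : pos_orthonormal (foot q) u v ->
  pos_orthonormal (foot_h q) (u *m iso q) (v *m iso q).
Proof.
case=> uu uv vv; rewrite det_col_mx => d0; split; rewrite ?iso_isometry //.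
by rewrite det_col_mx det2_mulmx mulr_gt0 // iso_oriented.
Qed.

Lemma on_bivector_curv (K : M -> R) l u v : gaussian_curvature K ->
  pos_orthonormal (foot q) u v ->
  on_bivector (curv (foot q)) (l *: wedge u v) u = (- l * K (foot q)) *: v.
Proof.
move=> hK uv; rewrite /on_bivector.
rewrite (on_bivector_wedge (F := fun a b => curv (foot q) a b u)).
- by rewrite (curv_frame uv hK) scalerA mulNr mulrN.
- by move=> *; exact: curv_linear_l.
- by move=> *; exact: curv_antisym.
Qed.

(** [iso q] carries the frame to a positive orthonormal frame of [Mh], where [curv_frame] applies;
    pulling back by the inverse gives a multiple of [v]. *)
Lemma on_bivector_curvh (Kh : Mh -> R) l u v : gaussian_curvature Kh ->
  pos_orthonormal (foot q) u v ->
  on_bivector (curvh q) (l *: wedge u v) u = (- l * Kh (foot_h q)) *: v.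
Proof.
move=> hK uv; rewrite /on_bivector.
rewrite (on_bivector_wedge (F := fun a b => curvh q a b u)).
- rewrite /curvh (curv_frame (iso_pos_orthonormal uv) hK).
  by rewrite -scalemxAl mulmxK ?iso_unit // scalerA mulNr mulrN.
- move=> a b c d; rewrite /curvh.
  have -> : (a *: b + c) *m iso q = a *: (b *m iso q) + c *m iso q.
    by rewrite mulmxDl -scalemxAl.
  rewrite curv_linear_l; move: (curv _ _ _ _) (curv _ _ _ _) => X Y.
  by rewrite mulmxDl -scalemxAl.
- move=> a b; rewrite /curvh curv_antisym; move: (curv _ _ _ _) => X.
  by rewrite mulNmx.
Qed.

End RollingCurvature.

(** * The scalar system along the curve *)

Section FrameEquations.
Variables (R : realType) (M Mh : orientedRiemannian R 2).
Variables (K : M -> R) (Kh : Mh -> R).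
Hypotheses (hK : gaussian_curvature K) (hKh : gaussian_curvature Kh).
Variables (T : R) (T0 : 0 < T) (q : R -> config M Mh).
Let I : set R := `[0, T]%classic.
Let gamma : R -> M := fun t => foot (q t).
Let e1 : R -> 'rV[R]_2 := velocity I gamma.
Variable e2 : R -> 'rV[R]_2.
Hypothesis he2 : forall t, 0 <= t <= T -> pos_orthonormal (gamma t) (e1 t) (e2 t).
Let kappa : R -> R := fun t => inner (gamma t) (covD I gamma e1 t) (e2 t).
Variables (V : R -> 'rV[R]_2) (Lambda : R -> 'M[R]_2).
Hypothesis hacc : forall t, 0 <= t <= T ->
  field_derivable I gamma e1 t /\
  covD I gamma e1 t =
    on_bivector (curv (gamma t)) (Lambda t) (e1 t)
    - on_bivector (curvh (q t)) (Lambda t) (e1 t).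
Hypothesis hLambda : forall t, 0 <= t <= T ->
  bifield_derivable I gamma Lambda t /\
  covD_bivec I gamma Lambda t = wedge (e1 t) (V t).
Hypothesis hV : forall t, 0 <= t <= T ->
  field_derivable I gamma V t /\
  covD I gamma V t = on_bivector (curvh (q t)) (Lambda t) (e1 t).
Variables lambda v1 v2 : R -> R.
Hypothesis hlambda : forall t, 0 <= t <= T ->
  Lambda t = lambda t *: wedge (e1 t) (e2 t).
Hypothesis hv : forall t, 0 <= t <= T -> V t = v1 t *: e1 t + v2 t *: e2 t.

Let inI t : I t -> 0 <= t <= T. Proof. by rewrite /I /= in_itv. Qed.

Lemma covD_e1 t : 0 <= t <= T -> covD I gamma e1 t =
  (- lambda t * (K (gamma t) - Kh (foot_h (q t)))) *: e2 t.
Proof.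
move=> tT; have [_ ->] := hacc tT; rewrite hlambda //.
rewrite (on_bivector_curv _ hK (he2 tT)) (on_bivector_curvh _ hKh (he2 tT)).
by rewrite -scalerBl -mulrBr.
Qed.

Lemma kappaE t : 0 <= t <= T ->
  kappa t = - lambda t * (K (gamma t) - Kh (foot_h (q t))).
Proof.
move=> tT; rewrite /kappa covD_e1 // innerZl.
by have [_ _ -> _] := he2 tT; rewrite mulr1.
Qed.

Lemma covD_V t : 0 <= t <= T -> covD I gamma V t =
  (- lambda t * Kh (foot_h (q t))) *: e2 t.
Proof.
move=> tT; have [_ ->] := hV tT; rewrite hlambda //.
by rewrite (on_bivector_curvh _ hKh (he2 tT)).
Qed.

Lemma deriv_lambda t : 0 <= t <= T -> deriv_in I lambda t (v2 t).
Proof.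
move=> tT; have It : I t by exact: mem_segment.
have [dL cL] := hLambda tT.
apply: (@deriv_in_eq _ _ _ It _ (fun s => bivec_area (gamma s) (Lambda s))).
  move=> s /inI sT; rewrite hlambda // bivec_areaZ.
  by rewrite (pos_orthonormal_area (he2 sT)) mulr1.
have aL s : 0 <= s <= T -> (Lambda s)^T = - Lambda s.
  by move=> sT; rewrite hlambda // linearZ /= wedge_antisym scalerN.
have := deriv_in_bivec_area T0 tT aL dL; congr deriv_in.
rewrite cL hv //; have := bivec_area_frame (he2 tT) 1 0 (v1 t) (v2 t).
by rewrite scale1r scale0r addr0 mul1r mul0r subr0.
Qed.

(** Here [v1 = <V, e1>]. The derivative of [V] is a multiple of [e2] and contributes nothing;
    [nabla e1 = kappa e2] contributes [kappa v2]. *)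
Lemma deriv_v1 t : 0 <= t <= T -> deriv_in I v1 t (kappa t * v2 t).
Proof.
move=> tT; have It : I t by exact: mem_segment.
have [dV _] := hV tT; have [de _] := hacc tT.
apply: (@deriv_in_eq _ _ _ It _ (fun s => inner (gamma s) (V s) (e1 s))).
  move=> s /inI sT; have [uu uv _ _] := he2 sT.
  by rewrite hv // innerDl !innerZl uu (inner_sym _ (e2 s)) uv mulr1 mulr0 addr0.
have := deriv_in_inner T0 tT dV de; congr deriv_in.
have [uu uv vv _] := he2 tT.
rewrite covD_V // covD_e1 // -kappaE // hv // innerZl innerZr innerDl !innerZl.
by rewrite uv (inner_sym _ (e2 t)) uv vv; ring.
Qed.

(** Of the two Leibniz terms, the wedge of [kappa e2] with [V] has area [- kappa v1], and the wedge
    of [e1] with [nabla V] has area [- lambda Kh]. *)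
Lemma deriv_v2 t : 0 <= t <= T -> deriv_in I v2 t
  (- kappa t * v1 t - Kh (foot_h (q t)) * lambda t).
Proof.
move=> tT; have It : I t by exact: mem_segment.
have [dV _] := hV tT; have [de _] := hacc tT.
apply: (@deriv_in_eq _ _ _ It _ (fun s => bivec_area (gamma s) (wedge (e1 s) (V s)))).
  move=> s /inI sT; rewrite hv //.
  have := bivec_area_frame (he2 sT) 1 0 (v1 s) (v2 s).
  by rewrite scale1r scale0r addr0 mul1r mul0r subr0.
have [bL cL] := deriv_in_wedge T0 tT de dV.
have aL s : 0 <= s <= T -> (wedge (e1 s) (V s))^T = - wedge (e1 s) (V s).
  by move=> _; exact: wedge_antisym.
have := deriv_in_bivec_area T0 tT aL bL; congr deriv_in.
rewrite cL bivec_areaD covD_e1 // -kappaE // covD_V // hv //.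
have := bivec_area_frame (he2 tT) 0 (kappa t) (v1 t) (v2 t).
rewrite scale0r add0r => ->.
have := bivec_area_frame (he2 tT) 1 0 0 (- lambda t * Kh (foot_h (q t))).
by rewrite scale1r !scale0r addr0 add0r => ->; ring.
Qed.

Lemma kappa_continuous_flat t : (forall xh, Kh xh = 0) -> 0 <= t <= T ->
  curve_derivable I gamma t ->
  kappa s @[s --> within I (nbhs t)] --> kappa t.
Proof.
move=> Kh0 tT [cg _]; have It : I t by exact: mem_segment.
have cK : K (gamma s) @[s --> within I (nbhs t)] --> K (gamma t).
  by apply: (cvg_comp gamma K cg); exact: (gaussian_curvature_continuous hK).
have cl := deriv_in_continuous It (deriv_lambda tT).
have E s : I s -> - (lambda s * K (gamma s)) = kappa s.
  by move=> /inI sT; rewrite kappaE // Kh0 subr0 mulNr.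
rewrite -E //.
have L : - (lambda s * K (gamma s)) @[s --> within I (nbhs t)] -->
    - (lambda t * K (gamma t)) by apply: cvgN; exact: cvgM.
apply: cvg_trans L; apply: near_eq_cvg.
by exists 1 => //= s _ Is; rewrite E.
Qed.

End FrameEquations.

(** * The pendulum equation *)

Lemma polar_coordinates (R : realType) (a b : R) :
  exists r theta, a = r * cos theta /\ b = r * sin theta.
Proof.
pose r := Num.sqrt (a ^+ 2 + b ^+ 2).
have r2 : r ^+ 2 = a ^+ 2 + b ^+ 2 by rewrite sqr_sqrtr // addr_ge0 ?sqr_ge0.
have [r0|r0] := eqVneq r 0.
  exists 0, 0; move/eqP: r2; rewrite r0 expr0n eq_sym paddr_eq0 ?sqr_ge0 //.
  by rewrite !sqrf_eq0 !mul0r => /andP[/eqP -> /eqP ->].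
have rp : 0 < r by rewrite lt_neqAle eq_sym r0 sqrtr_ge0.
have ar : -1 <= a / r <= 1.
  rewrite -ler_norml -(@expr_le1 _ 2) // -normrX ger0_norm ?sqr_ge0 //.
  by rewrite expr_div_n ler_pdivrMr ?exprn_gt0 // mul1r r2 lerDl sqr_ge0.
have sb : Num.sqrt (1 - (a / r) ^+ 2) = `|b| / r.
  have -> : 1 - (a / r) ^+ 2 = (b / r) ^+ 2.
    have -> : 1 = (a ^+ 2 + b ^+ 2) / r ^+ 2.
      by rewrite -r2 divff // expf_neq0.
    by field.
  by rewrite sqrtr_sqr normf_div [`|r|]gtr0_norm.
have ca : r * cos (acos (a / r)) = a by rewrite acosK ?in_itv //= mulrC divfK.
have sa : r * sin (acos (a / r)) = `|b| by rewrite sin_acos // sb mulrC divfK.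
(* The sine is nonnegative on the range of [acos], so that angle only recovers the absolute value of
   [b]; a negative [b] takes the opposite angle. *)
have [b0|b0] := leP 0 b.
  by exists r, (acos (a / r)); rewrite ca sa ger0_norm.
exists r, (- acos (a / r)); rewrite cosN sinN ca mulrN sa ltr0_norm //.
by rewrite opprK.
Qed.

Section Angle.
Variables (R : realType) (T : R).
Hypothesis T0 : 0 < T.
Let I : set R := `[0, T]%classic.
Variable kappa : R -> R.
Hypothesis ckappa : forall t, 0 <= t <= T ->
  kappa s @[s --> within I (nbhs t)] --> kappa t.
Let mu := @lebesgue_measure R.

Lemma integrable_segment : mu.-integrable I (EFin \o kappa).
Proof.
apply: continuous_compact_integrable; first exact: segment_compact.
apply/subspace_continuousP => t; rewrite /I /= in_itv => tT.
by have := ckappa tT.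
Qed.

Lemma angle0 theta0 : angle kappa theta0 0 = theta0.
Proof. by rewrite /angle set_itv1 Rintegral_set1 addr0. Qed.

Lemma deriv_angle theta0 t : 0 <= t <= T ->
  deriv_in I (angle kappa theta0) t (kappa t).
Proof.
move=> tT; have It : I t by exact: mem_segment.
(* Continuity of [kappa] is given on the segment only; composing with this retraction extends it
   continuously to the whole line. *)
pose clamp (s : R) := Num.max 0 (Num.min s T).
have clampI s : I (clamp s).
  by rewrite /I /= in_itv /= /clamp le_max lexx /= ge_max (ltW T0) ge_min lexx orbT.
have clampE s : I s -> clamp s = s.
  rewrite /I /= in_itv /= /clamp => /andP[s0 sT].
  by rewrite (min_idPl sT); apply/max_idPr.
pose k := kappa \o clamp.
have ck : continuous k.
  move=> s; have c1 : clamp u @[u --> s] --> clamp s.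
    have cm : {for s, continuous (fun u : R => Num.min u T : R^o)}.
      by apply: (@continuous_min _ _ id (cst T)); [exact: cvg_id | exact: cst_continuous].
    by apply: (@continuous_max _ _ (cst 0) _ s _ cm); exact: cst_continuous.
  have c2 : clamp u @[u --> s] --> within I (nbhs (clamp s)).
    move=> P HP; have : nbhs s (fun u => I (clamp u) -> P (clamp u)) := c1 _ HP.
    by apply: filterS => u; apply; exact: clampI.
  have := ckappa (t := clamp s); rewrite -/(I (clamp s)) => c3.
  by apply: (cvg_comp _ _ c2); apply: c3; have := clampI s; rewrite /I /= in_itv.
have intk (a b : R) : mu.-integrable `[a, b] (EFin \o k).
  apply: continuous_compact_integrable; first exact: segment_compact.
  exact: continuous_subspaceT.
(* With lower limit -1 every [t] of the segment, 0 included, is interior, so the fundamental theorem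
   gives a two-sided derivative. The change of lower limit costs the constant [F 0]. *)
pose F x := \int[mu]_(s in `[-1, x]) k s.
have t1 : -1 < t by rewrite (lt_le_trans (ltrN10 R)) //; case/andP: tT.
have [dF DF] : derivable F t 1 /\ F^`()%classic t = k t.
  by apply: (@continuous_FTC1_closed _ k (-1) t (t + 1)); rewrite ?ltrDl //; exact: ck.
have dF' : is_derive t 1 F (kappa t).
  by split => //; rewrite -derive1E DF /k /= clampE.
have dF1 : deriv_in I F t (kappa t).
  by apply: (is_derive_deriv_in It _ dF'); exact: nearW.
have := deriv_inD It dF1 (deriv_in_cst It (theta0 - F 0)); rewrite addr0.
apply: (deriv_in_eq It) => s Is.
rewrite /angle addrCA; congr (_ + _).
have [s0 sT] : 0 <= s /\ s <= T by move: Is; rewrite /I /= in_itv => /andP.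
rewrite /F (@Rintegral_itvB _ _ (BLeft (-1)) (BRight s) 0) ?bnd_simp //.
rewrite Rintegral_itv_obnd_cbnd.
  apply: eq_Rintegral => u; rewrite inE /= in_itv /= => /andP[u0 us].
  by rewrite /k /= clampE // /I /= in_itv /= u0 (le_trans us).
apply: integrableS (intk 0 s) => //.
by apply: subset_itvr; rewrite bnd_simp.
Qed.

(** The vector [(x, y)] turned by [theta] has zero derivative, so its components [C1] and [C2] keep
    their initial values [r] and 0, and turning back yields [y]. *)
Lemma rotation_angle (x y : R -> R) :
  (forall t, 0 <= t <= T -> deriv_in I x t (kappa t * y t)) ->
  (forall t, 0 <= t <= T -> deriv_in I y t (- kappa t * x t)) ->
  exists r theta0, forall t, 0 <= t <= T ->
    y t = - r * sin (angle kappa theta0 t).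
Proof.
(* The sign of [y 0] is reversed because [(x, y)] turns clockwise as [theta] grows; this angle makes
   the turned vector start at [(r, 0)]. *)
move=> dx dy; have [r [theta0 [x0 y0]]] := polar_coordinates (x 0) (- y 0).
exists r, theta0; set theta := angle kappa theta0.
have dtheta t (tT : 0 <= t <= T) : deriv_in I theta t (kappa t).
  exact: deriv_angle.
have dcos t (tT : 0 <= t <= T) := deriv_in_comp1 (mem_segment tT)
  (is_derive_cos (theta t)) (dtheta t tT).
have dsin t (tT : 0 <= t <= T) := deriv_in_comp1 (mem_segment tT)
  (is_derive_sin (theta t)) (dtheta t tT).
have C1 t : 0 <= t <= T -> x t * cos (theta t) - y t * sin (theta t) = r.
  move=> tT.
  rewrite (deriv_in0_cst (f := fun s => x s * cos (theta s) - y s * sin (theta s)) _ tT).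
    rewrite /theta angle0 x0 -[y 0]opprK y0.
    rewrite -[RHS]mulr1 -(cos2Dsin2 theta0); ring.
  move=> s sT; have Is := mem_segment sT.
  have := deriv_inB Is (deriv_inM Is (dx s sT) (dcos s sT))
    (deriv_inM Is (dy s sT) (dsin s sT)).
  by congr deriv_in => /=; ring.
have C2 t : 0 <= t <= T -> x t * sin (theta t) + y t * cos (theta t) = 0.
  move=> tT.
  rewrite (deriv_in0_cst (f := fun s => x s * sin (theta s) + y s * cos (theta s)) _ tT).
    by rewrite /theta angle0 x0 -[y 0]opprK y0; ring.
  move=> s sT; have Is := mem_segment sT.
  have := deriv_inD Is (deriv_inM Is (dx s sT) (dsin s sT))
    (deriv_inM Is (dy s sT) (dcos s sT)).
  by congr deriv_in => /=; ring.
move=> t tT; rewrite -(C1 t tT).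
rewrite -[LHS]mulr1 -(cos2Dsin2 (theta t)).
have -> : y t * (cos (theta t) ^+ 2 + sin (theta t) ^+ 2) =
   - (x t * cos (theta t) - y t * sin (theta t)) * sin (theta t)
   + cos (theta t) * (x t * sin (theta t) + y t * cos (theta t)) by ring.
by rewrite C2 // mulr0 addr0.
Qed.

End Angle.

Lemma deriv_in_has_derivative_on (R : realType) (T : R) (f f' : R -> R) :
  0 < T -> (forall t, 0 <= t <= T -> deriv_in `[0, T] f t (f' t)) ->
  has_derivative_on T f f'.
Proof. by move=> T0 H t tT; apply: deriv_in_derive => //; exact: H. Qed.

Theorem corollary3p5 (R : realType) (M Mh : orientedRiemannian R 2)
  (K : M -> R) (hK : gaussian_curvature K)
  (Kh : Mh -> R) (hKh : gaussian_curvature Kh)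
  (hKKh : forall (x : M) (xh : Mh), K x != Kh xh)
  (T : R) (hT : 0 < T) (q : R -> config M Mh) (hq : minimal_rolling T q) :
  let I : set R := `[0, T]%classic in
  let gamma : R -> M := fun t => foot (q t) in
  let e1 : R -> 'rV[R]_2 := velocity I gamma in
  forall (arclength : forall t, 0 <= t <= T ->
    curve_derivable I gamma t /\ tnorm (gamma t) (e1 t) = 1)
  (e2 : R -> 'rV[R]_2)
  (he2 : forall t, 0 <= t <= T -> pos_orthonormal (gamma t) (e1 t) (e2 t)),
  let kappa : R -> R := fun t => inner (gamma t) (covD I gamma e1 t) (e2 t) in
  forall (V : R -> 'rV[R]_2) (Lambda : R -> 'M[R]_2)
  (hacc : forall t, 0 <= t <= T ->
    field_derivable I gamma e1 t /\
    covD I gamma e1 t =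
      on_bivector (curv (gamma t)) (Lambda t) (e1 t)
      - on_bivector (curvh (q t)) (Lambda t) (e1 t))
  (hLambda : forall t, 0 <= t <= T ->
    bifield_derivable I gamma Lambda t /\
    covD_bivec I gamma Lambda t = wedge (e1 t) (V t))
  (hV : forall t, 0 <= t <= T ->
    field_derivable I gamma V t /\
    covD I gamma V t = on_bivector (curvh (q t)) (Lambda t) (e1 t))
  (lambda v1 v2 : R -> R)
  (hlambda : forall t, 0 <= t <= T ->
    Lambda t = lambda t *: wedge (e1 t) (e2 t))
  (hv : forall t, 0 <= t <= T -> V t = v1 t *: e1 t + v2 t *: e2 t),
  [/\ forall kh : R, (forall xh, Kh xh = kh) ->
        exists c : R, forall t, 0 <= t <= T ->
          v1 t ^+ 2 + v2 t ^+ 2 + kh * lambda t ^+ 2 = c,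
      (forall xh, Kh xh = 0) ->
        exists A theta0 : R,
          pendulum_over T kappa (fun t => K (gamma t)) A theta0 &
      forall k kh : R, (forall x, K x = k) -> (forall xh, Kh xh = kh) ->
        exists A theta0 : R, pendulum T kappa A theta0].

Proof.
move=> I gamma e1 arclength e2 he2 kappa V Lambda hacc hLambda hV lambda v1 v2
  hlambda hv.
have dl := deriv_lambda hT he2 hLambda hlambda hv.
have dv1 t : 0 <= t <= T -> deriv_in I v1 t (kappa t * v2 t).
  exact: (deriv_v1 hK hKh hT he2 hacc hV hlambda hv).
have dv2 t : 0 <= t <= T ->
    deriv_in I v2 t (- kappa t * v1 t - Kh (foot_h (q t)) * lambda t).
  exact: (deriv_v2 hK hKh hT he2 hacc hV hlambda hv).
have kE t : 0 <= t <= T ->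
    kappa t = - lambda t * (K (gamma t) - Kh (foot_h (q t))).
  exact: (kappaE hK hKh he2 hacc hlambda).
have inI t : I t -> 0 <= t <= T by rewrite /I /= in_itv.
split.
- move=> kh khE; pose E s := v1 s ^+ 2 + v2 s ^+ 2 + kh * lambda s ^+ 2.
  exists (E 0) => t tT; apply: (deriv_in0_cst (f := E) _ tT) => s sT.
  have Is := mem_segment sT.
  (* The terms in [kappa] cancel between the two squares, and [- 2 kh lambda v2] from [v2 ^+ 2]
     cancels the derivative of the last summand. *)
  have := deriv_inD Is (deriv_inD Is (deriv_inM Is (dv1 s sT) (dv1 s sT))
    (deriv_inM Is (dv2 s sT) (dv2 s sT)))
    (deriv_inZ Is (k := kh) (deriv_inM Is (dl s sT) (dl s sT))).
  by congr deriv_in; rewrite khE; ring.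
- move=> Kh0.
  have ck t (tT : 0 <= t <= T) := kappa_continuous_flat hK hKh hT he2 hacc
    hLambda hlambda hv Kh0 tT (arclength t tT).1.
  have [r [theta0 rE]] : exists r theta0, forall t, 0 <= t <= T ->
      v2 t = - r * sin (angle kappa theta0 t).
    apply: rotation_angle dv1 _ => // t tT.
    by have := dv2 t tT; rewrite Kh0 mul0r subr0.
  exists r, theta0; split; first exact: integrable_segment.
  exists kappa; apply: deriv_in_has_derivative_on => // t tT.
    exact: deriv_angle.
  have It := mem_segment tT.
  (* The function to differentiate is [- lambda]: it equals [kappa / K], with [K] nonzero because it
     differs from [Kh = 0], and its derivative is [- v2 = r sin theta], whence [A = r]. *)
  have := deriv_inZ It (k := -1) (dl t tT).
  rewrite mulN1r rE // mulNr opprK.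
  apply: (deriv_in_eq It) => s /inI sT.
  rewrite kE // Kh0 subr0 mulfK ?mulN1r //.
  by have := hKKh (gamma s) (foot_h (q s)); rewrite Kh0.
- move=> k kh kE' khE.
  have kkh : k - kh != 0.
    by have := hKKh (gamma 0) (foot_h (q 0)); rewrite kE' khE subr_eq0.
  have dk t : 0 <= t <= T -> deriv_in I kappa t (- (k - kh) * v2 t).
    move=> tT; have It := mem_segment tT.
    have := deriv_inZ It (k := - (k - kh)) (dl t tT).
    apply: (deriv_in_eq It) => s /inI sT.
    by rewrite kE // kE' khE; ring.
  have ck t (tT : 0 <= t <= T) := deriv_in_continuous (mem_segment tT) (dk t tT).
  have [r [theta0 rE]] : exists r theta0, forall t, 0 <= t <= T ->
      v2 t = - r * sin (angle kappa theta0 t).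
    (* The shift absorbs the forcing term: as [lambda = - kappa / (k - kh)], the derivative
       [- kappa v1 - kh lambda] of [v2] equals [- kappa (v1 - kh / (k - kh))]. *)
    apply: (@rotation_angle _ _ hT _ ck (fun s => v1 s - kh / (k - kh))) => t tT.
      have It := mem_segment tT.
      by have := deriv_inB It (dv1 t tT) (deriv_in_cst It _); rewrite subr0; exact.
    have := dv2 t tT; congr deriv_in; rewrite khE kE // kE' khE; field.
    by [].
  (* This constant comes from [kappa' = - (k - kh) v2] and [v2 = - r sin theta]. *)
  exists ((k - kh) * r), theta0; split; first exact: integrable_segment.
  exists kappa; apply: deriv_in_has_derivative_on => // t tT.
    exact: deriv_angle.
  have := dk t tT; congr deriv_in; rewrite rE //; ring.
Qed.
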